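(* Let $p\notin\{2,11\}$ be a prime and let $\ell\in\{0,1,\dots,N_p-1\}$ satisfy: (i) $p\mid T(\ell)$; (ii) $T(\ell+N_p)\not\equiv T(\ell)\pmod{p^2}$; and, with $$u:=\ell-\frac{T(\ell)}{p}\Bigl(\frac{T(\ell+N_p)-T(\ell)}{p}\Bigr)^{-1}N_p$$ (the inverse taken modulo $p$, which exists by (ii)), (iii) $u\not\equiv0,-1,-4,-17\pmod p$. Then $\mathrm{ML}(p)$ fails. Similarly, if $p\ne3$ and (i), (ii) hold together with (iii') $u\not\equiv0,-1,-4,-17,1/3,-5/3\pmod p$, then $\mathrm{MLR}(p)$ fails.
   Context: $T$ is the Tribonacci sequence ($T(0)=0,T(1)=T(2)=1$, $T(n+3)=T(n+2)+T(n+1)+T(n)$, $n\in\mathbb Z$); $\nu_p$ is the $p$-adic valuation, $\nu_p(0)=\infty$. $N_p$ is the order of the subgroup of $(\mathcal O/p\mathcal O)^\times$ generated by the images of the roots of $X^3-X^2-X-1$, where $\mathcal O$ is the ring of integers of the splitting field of this polynomial over $\mathbb Q_p$. Congruences of rationals modulo $M$: $x\equiv y\pmod M$ means $mx\equiv my\pmod M$ for some $m\in\mathbb Z$ coprime to $M$ with $mx,my\in\mathbb Z$. $\mathrm{ML}(p)$: there exists a positive integer $Q$ such that for every $i\in\{0,\dots,Q-1\}$ either (C) there is $\kappa_i\in\mathbb Z_{\ge0}$ with $\nu_p(T(n))=\kappa_i$ for all but finitely many $n\in\mathbb Z$, $n\equiv i\pmod Q$, or (L) there exist $a_i\in\mathbb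 Z$, $\kappa_i\in\mathbb Z$, $\mu_i\in\mathbb Z_{>0}$ with $\nu_p(a_i-i)\ge\nu_p(Q)$ and $\nu_p(T(n))=\kappa_i+\mu_i\nu_p(n-a_i)$ for all but finitely many $n\in\mathbb Z$, $n\equiv i\pmod Q$. $\mathrm{MLR}(p)$ is the same statement with $a_i\in\mathbb Q$ allowed in (L). *)

(* Defs.v *)
From HB Require Import structures.
From mathcomp Require Import all_boot all_order all_algebra.
Set Implicit Arguments. Unset Strict Implicit. Unset Printing Implicit Defensive.
Import Order.TTheory GRing.Theory Num.Theory.
Local Open Scope ring_scope.

Fixpoint Tfwd (n : nat) : int * int * int :=
  match n with
  | O => (0, 1, 1)
  | S n' => let '(a, b, c) := Tfwd n' in (b, c, a + b + c)
  end.
(* Tbwd n = (T (-n), T (-n+1), T (-n+2)), using T(m) = T(m+3) - T(m+2) - T(m+1) *)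
Fixpoint Tbwd (n : nat) : int * int * int :=
  match n with
  | O => (0, 1, 1)
  | S n' => let '(a, b, c) := Tbwd n' in (c - b - a, a, b)
  end.
Definition T (z : int) : int :=
  match z with
  | Posz n => (Tfwd n).1.1
  | Negz n => (Tbwd n.+1).1.1
  end.

(* ---------- p-adic valuation on Q, None = +infinity ---------- *)
Definition vq (p : nat) (x : rat) : option int :=
  if x == 0 then None
  else Some ((logn p `|numq x|)%:Z - (logn p `|denq x|)%:Z).

Definition congq (M : int) (x y : rat) : Prop :=
  exists m : int, coprimez m M /\
    exists a b : int, m%:~R * x = a%:~R /\ m%:~R * y = b%:~R /\ (a == b %[mod M])%Z.

(* Order of the subgroup of L^x generated by r1 r2 r3 (L finite): every element
   of this subgroup is r1^a r2^b r3^c with 0 <= a,b,c < #|L|, since r^(#|L|-1)=1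
   for r <> 0, so inverses are nonnegative powers. *)
Definition gen_order (L : finFieldType) (r1 r2 r3 : L) : nat :=
  #|[set r1 ^+ x.1.1 * r2 ^+ x.1.2 * r3 ^+ x.2
      | x : 'I_#|L| * 'I_#|L| * 'I_#|L|]|.

Definition tribpoly (R : nzRingType) : {poly R} := 'X^3 - 'X^2 - 'X - 1.

Definition cofin_cong (Q : nat) (i : int) (P : int -> Prop) : Prop :=
  exists B : nat, forall n : int, (B <= `|n|)%N -> (n == i %[mod Q%:Z])%Z -> P n.

Definition caseC (p Q : nat) (i : int) : Prop :=
  exists kappa : nat, cofin_cong Q i (fun n => vq p (T n)%:~R = Some kappa%:Z).

Definition vge (x y : option int) : Prop :=
  match x, y with
  | None, _ => True
  | Some _, None => False
  | Some v, Some w => w <= v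
  end.

(* case (L) for a given a_i (rational); nu_p(T n) = kappa + mu * nu_p(n - a),
   with the convention kappa + mu * infinity = infinity *)
Definition caseL (p Q : nat) (i : int) (a : rat) : Prop :=
  exists (kappa : int) (mu : nat), (0 < mu)%N /\
    vge (vq p (a - i%:~R)) (vq p Q%:R) /\
    cofin_cong Q i (fun n =>
      vq p (T n)%:~R = omap (fun v => kappa + mu%:Z * v) (vq p (n%:~R - a))).

Definition ML (p : nat) : Prop :=
  exists Q : nat, (0 < Q)%N /\ forall i : nat, (i < Q)%N ->
    caseC p Q i \/ exists a : int, caseL p Q i a%:~R.

Definition MLR (p : nat) : Prop :=
  exists Q : nat, (0 < Q)%N /\ forall i : nat, (i < Q)%N ->
    caseC p Q i \/ exists a : rat, caseL p Q i a.

(* u := l - (T(l)/p) * w * N, where w is an inverse mod p of (T(l+N)-T(l))/p *)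
Definition u_of (p N : nat) (l : nat) (w : int) : rat :=
  l%:R - ((T l)%:~R / p%:R) * w%:~R * N%:R.

(* Main.v *)
(* Write T(n) = sum_i c_i r_i^n over the roots r_i of P = X^3 - X^2 - X - 1. As
   r_i^N = 1 mod p, conditions (i) and (ii) give by Hensel's lemma a p-adic zero
   z = u mod p of T on the class l mod N. On a suitable class modulo Q it makes
   the valuation of T unbounded, which excludes (C), and it forces a = z in (L).
   So let z = b/d be rational. Then sum_i c_i w_i = 0 for algebraic numbers w_i
   with w_i^(dN) = r_i^(bN). An automorphism of the algebraic numbers maps w_i to
   a root of unity times a conjugate w_j, and that root of unity does not depend
   on i: otherwise the ratios of the c_i w_i would lie in an abelian extension of
   Q, so the c_i w_i would have equal norms, the cubes (c_i w_i)^3 would coincide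
   and the P'(r_i)^3 / 44 would be algebraic integers of trace 196 / 44. Hence
   w_i^3 / (w_0 w_1 w_2) is a unit of Q(r_i), and as r_i is a fundamental unit it
   is r_i^c with c = 3 z an integer. Expanding the cube of the relation gives
   sum_i c_i^3 r_i^c = 3 c_0 c_1 c_2, an equation whose only solutions, found by
   Skolem's method at the prime 397 (where the r_i have order dividing 132), are
   c = 0, -3, -12, -51, 1, -5. *)

Require Import Defs.
From Stdlib Require Import ZArith.
From HB Require Import structures.
From mathcomp Require Import all_boot all_order all_fingroup all_algebra all_field.
From mathcomp Require Import ring lra zify ssrZ.
Set Implicit Arguments. Unset Strict Implicit. Unset Printing Implicit Defensive.
Import Order.TTheory GRing.Theory Num.Theory.
Local Open Scope ring_scope.

(** * Roots of the Tribonacci polynomial *)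

Lemma horner_tribpoly (R : comNzRingType) (x : R) :
  (tribpoly R).[x] = x ^+ 3 - x ^+ 2 - x - 1.
Proof. by rewrite /tribpoly !hornerE. Qed.

Lemma size_tribpoly (R : comNzRingType) : size (tribpoly R) = 4%N.
Proof.
rewrite /tribpoly -!addrA size_polyDl size_polyXn //.
apply: (leq_ltn_trans (size_polyD _ _)); rewrite size_polyN size_polyXn gtn_max /=.
apply: (leq_ltn_trans (size_polyD _ _)).
by rewrite size_polyN size_polyX size_polyN size_poly1.
Qed.

Lemma monic_tribpoly (R : comNzRingType) : tribpoly R \is monic.
Proof.
by rewrite monicE /lead_coef size_tribpoly /tribpoly !coefE /= !subr0.
Qed.

Lemma tribpoly_vieta (R : idomainType) (a b c : R) :
  tribpoly R = ('X - a%:P) * ('X - b%:P) * ('X - c%:P) ->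
  [/\ a + b + c = 1, a * b + b * c + c * a = -1 & a * b * c = 1].
Proof.
move=> e.
have E : ('X - a%:P) * ('X - b%:P) * ('X - c%:P) =
  'X^3 - (a + b + c) *: 'X^2 + (a * b + b * c + c * a) *: 'X - (a * b * c)%:P.
  by rewrite -!mul_polyC !rmorphD !rmorphM /=; ring.
rewrite E in e.
split.
- by move/(congr1 (fun p : {poly R} => p`_2)): e; rewrite /tribpoly !coefE /=
    !(mulr1, mulr0, subr0, addr0, sub0r) => /oppr_inj.
- by move/(congr1 (fun p : {poly R} => p`_1)): e; rewrite /tribpoly !coefE /=
    !(mulr1, mulr0, subr0, addr0, sub0r, oppr0, add0r).
- by move/(congr1 (fun p : {poly R} => p`_0)): e; rewrite /tribpoly !coefE /=
    !(mulr1, mulr0, subr0, addr0, sub0r, oppr0, add0r) => /oppr_inj.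
Qed.

(** The left side is the discriminant. Its value [- 2 ^ 2 * 11] is why the primes 2 and 11 are
    excluded, and its sign gives a pair of non-real roots. *)
Lemma tribpoly_disc (R : idomainType) (a b c : R) :
  tribpoly R = ('X - a%:P) * ('X - b%:P) * ('X - c%:P) ->
  ((a - b) * (b - c) * (c - a)) ^+ 2 = - 44%:R.
Proof.
case/tribpoly_vieta => e1 e2 e3.
have -> : ((a - b) * (b - c) * (c - a)) ^+ 2 =
  (a + b + c) ^+ 2 * (a * b + b * c + c * a) ^+ 2 - 4 * (a * b + b * c + c * a) ^+ 3
  - 4 * (a + b + c) ^+ 3 * (a * b * c)
  + 18 * (a + b + c) * (a * b + b * c + c * a) * (a * b * c) - 27 * (a * b * c) ^+ 2.
  ring.
by rewrite e1 e2 e3; ring.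
Qed.

Lemma map_tribpoly (R S : comNzRingType) (f : {rmorphism R -> S}) :
  map_poly f (tribpoly R) = tribpoly S.
Proof. by rewrite /tribpoly !rmorphB /= !map_polyXn map_polyX rmorph1. Qed.

Definition trib_roots (r : 'I_3 -> algC) :=
  tribpoly algC = \prod_i ('X - (r i)%:P).

Lemma sum3 (V : nmodType) (f : 'I_3 -> V) :
  \sum_i f i = f 0 + f 1 + f 2%:R.
Proof.
rewrite !big_ord_recl big_ord0 addr0 addrA; congr (_ + f _ + f _); exact/val_inj.
Qed.

Lemma prod3 (R : pzSemiRingType) (f : 'I_3 -> R) :
  \prod_i f i = f 0 * f 1 * f 2%:R.
Proof.
rewrite !big_ord_recl big_ord0 mulr1 mulrA; congr (_ * f _ * f _); exact/val_inj.
Qed.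

Lemma ord3P (P : 'I_3 -> Prop) : P 0 -> P 1 -> P 2%:R -> forall i, P i.
Proof.
move=> P0 P1 P2 [[|[|[|//]]] h].
- by rewrite (_ : Ordinal h = 0) //; apply: val_inj.
- by rewrite (_ : Ordinal h = 1) //; apply: val_inj.
- by rewrite (_ : Ordinal h = 2%:R) //; apply: val_inj.
Qed.

Lemma trib_roots_exist : exists r, trib_roots r.
Proof.
have [s Ds] := closed_field_poly_normal (tribpoly algC).
rewrite (monicP (monic_tribpoly _)) scale1r in Ds.
have sz : size s = 3.
  have := size_tribpoly algC; rewrite Ds size_prod_XsubC.
  by case.
exists (fun i : 'I_3 => s`_i); rewrite /trib_roots Ds (big_nth 0) sz big_mkord.
by apply: eq_bigr.
Qed.

Section Roots.

Variables (r : 'I_3 -> algC) (rP : trib_roots r).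

Lemma trib_roots_vieta :
  [/\ r 0 + r 1 + r 2%:R = 1, r 0 * r 1 + r 1 * r 2%:R + r 2%:R * r 0 = -1
    & r 0 * r 1 * r 2%:R = 1].
Proof. by apply: tribpoly_vieta; rewrite -(prod3 (fun i => 'X - (r i)%:P)). Qed.

Lemma trib_roots_disc :
  ((r 0 - r 1) * (r 1 - r 2%:R) * (r 2%:R - r 0)) ^+ 2 = - 44%:R.
Proof. by apply: tribpoly_disc; rewrite -(prod3 (fun i => 'X - (r i)%:P)). Qed.

Lemma root_tribP x : reflect (exists i, x = r i) (root (tribpoly algC) x).
Proof.
rewrite rP; apply: (iffP idP) => [|[i ->]].
  rewrite /root horner_prod => /prodf_eq0[i _].
  by rewrite !hornerE subr_eq0 => /eqP ->; exists i.
by rewrite /root horner_prod (bigD1 i) //= !hornerE subrr mul0r.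
Qed.

Lemma trib_rootE i : r i ^+ 3 = r i ^+ 2 + r i + 1.
Proof.
have /eqP : root (tribpoly algC) (r i) by apply/root_tribP; exists i.
rewrite horner_tribpoly => h.
by rewrite -[LHS]subr0 -h; ring.
Qed.

Lemma trib_root_neq0 i : r i != 0.
Proof.
apply/eqP=> r0; have := trib_rootE i; rewrite r0 !expr0n /= !add0r => /eqP.
by rewrite eq_sym oner_eq0.
Qed.

Lemma trib_roots_inj : injective r.
Proof.
have d0 : (r 0 - r 1) * (r 1 - r 2%:R) * (r 2%:R - r 0) != 0.
  by rewrite -sqrf_eq0 trib_roots_disc oppr_eq0 pnatr_eq0.
have [d01 d12 d20] : [/\ r 0 != r 1, r 1 != r 2%:R & r 2%:R != r 0].
  move: d0; rewrite !mulf_eq0 !negb_or !subr_eq0.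
  by case/andP=> /andP[-> ->] ->.
apply: ord3P; apply: ord3P => // /eqP; first [by rewrite (negPf d01)
 | by rewrite (negPf d12) | by rewrite (negPf d20) | by rewrite eq_sym (negPf d01)
 | by rewrite eq_sym (negPf d12) | by rewrite eq_sym (negPf d20)].
Qed.

Lemma prod_trib_roots : \prod_i r i = 1.
Proof. by rewrite prod3; case: trib_roots_vieta. Qed.

Lemma trib_psum1 : \sum_i r i = 1.
Proof. by rewrite sum3; case: trib_roots_vieta. Qed.

Lemma trib_psum2 : \sum_i r i ^+ 2 = 3%:R.
Proof.
rewrite sum3; case: trib_roots_vieta => e1 e2 _.
transitivity ((r 0 + r 1 + r 2%:R) ^+ 2 - 2%:R * (r 0 * r 1 + r 1 * r 2%:R + r 2%:R * r 0)).
  by ring.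
by rewrite e1 e2; ring.
Qed.

Lemma Aint_trib_root i : r i \in Aint.
Proof.
apply: (@root_monic_Aint (tribpoly algC)); last 2 first.
- exact: monic_tribpoly.
- by apply/polyOverP=> k; rewrite -(map_tribpoly (intr : int -> algC)) coef_map intr_int.
by apply/root_tribP; exists i.
Qed.

Lemma trib_rootV i : (r i)^-1 = r i ^+ 2 - r i - 1.
Proof.
apply: (mulfI (trib_root_neq0 i)); rewrite divff ?trib_root_neq0 //.
have h := trib_rootE i; by ring: h.
Qed.

Lemma Aint_trib_rootX i (b : int) : r i ^ b \in Aint.
Proof.
have rA := Aint_trib_root i.
case: b => n; first by rewrite -exprnP rpredX.
by rewrite NegzE -exprz_inv -exprnP trib_rootV rpredX // !rpredB ?rpred1 ?rpredX.
Qed.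

(* [44 * x / P'(x)] for a root [x] of [P = X^3 - X^2 - X - 1] *)
Definition binet_coef (x : algC) := 10%:R * x ^+ 2 - 6%:R * x - 8%:R.

Lemma binet_coefE i :
  binet_coef (r i) * (3%:R * r i ^+ 2 - 2%:R * r i - 1) = 44%:R * r i.
Proof. rewrite /binet_coef; have h := trib_rootE i; by ring: h. Qed.

Lemma binet_coef_neq0 i : binet_coef (r i) != 0.
Proof.
apply/eqP=> e0; have := binet_coefE i; rewrite e0 mul0r => /esym/eqP.
by rewrite mulf_eq0 pnatr_eq0 (negPf (trib_root_neq0 i)).
Qed.

Lemma Aint_binet_coef i : binet_coef (r i) \in Aint.
Proof.
have rA := Aint_trib_root i.
by rewrite /binet_coef !rpredB ?rpredM ?rpredX ?rpred_nat.
Qed.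

(** The trace of an element of [Q(X) / (P)] in reduced form; the traces below are computed by
    reducing modulo [P]. *)
Lemma trib_sum_quad (a b c : algC) :
  \sum_i (a * r i ^+ 2 + b * r i + c) = 3%:R * a + b + 3%:R * c.
Proof.
rewrite !big_split /= -!mulr_sumr trib_psum1 trib_psum2 sumr_const card_ord; ring.
Qed.

(** The norm of [44 * x / P'(x)], that is [44 ^ 3 / 44], since [x] has norm 1 and [P'(x)] has norm
    44. *)
Lemma prod_binet_coef : \prod_i binet_coef (r i) = 1936%:R.
Proof.
rewrite prod3; case: trib_roots_vieta => e1 e2 e3.
have -> : r 2%:R = 1 - r 0 - r 1 by rewrite -e1; ring.
move: e2 e3; rewrite (_ : r 2%:R = 1 - r 0 - r 1); last by rewrite -e1; ring.
set x := r 0; set y := r 1 => e2 e3.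
have h := trib_rootE 0; rewrite -/x in h.
have h2 : y ^+ 2 = y - x * y + x - x ^+ 2 + 1 by rewrite -[LHS]addr0 -(subrr (-1 : algC)) -{1}e2; ring.
by rewrite /binet_coef; ring: h h2.
Qed.

Lemma trib_sum_deriv3 : \sum_i (3%:R * r i ^+ 2 - 2%:R * r i - 1) ^+ 3 = 196%:R.
Proof.
rewrite (eq_bigr (fun i => 16%:R * r i ^+ 2 + 40%:R * r i + 36%:R)) => [|i _].
  by rewrite trib_sum_quad; ring.
have h := trib_rootE i; by ring: h.
Qed.

End Roots.

(** * Congruences between algebraic integers *)

Lemma dvdAP (e : nat) (x : algC) : (0 < e)%N ->
  reflect (exists2 y, y \in Aint & x = e%:R * y) (e %| x)%A.
Proof.
move=> e0; have nz : e%:R != 0 :> algC by rewrite pnatr_eq0 -lt0n.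
rewrite [(_ %| _)%A]unfold_in /= (negPf nz); apply: (iffP idP) => [h|[y yA ->]].
  by exists (x / e%:R) => //; rewrite mulrC divfK.
by rewrite mulrC mulKf.
Qed.

Lemma dvdA_mulr (e x y : algC) : y \in Aint -> (e %| x)%A -> (e %| x * y)%A.
Proof.
move=> yA; rewrite ![(_ %| _)%A]unfold_in; case: ifP => _ => [/eqP ->|h]; first by rewrite mul0r.
by rewrite mulrAC rpredM.
Qed.

Lemma dvdA_int (e : nat) (x : int) : (0 < e)%N ->
  (e %| x%:~R)%A = (e%:Z %| x)%Z.
Proof.
move=> e0; have nz : e%:R != 0 :> algC by rewrite pnatr_eq0 -lt0n.
apply/(dvdAP _ e0)/dvdzP => [[y yA Dx]|[m ->]].
  have yQ : y \in Crat by rewrite -(mulKf nz y) -Dx rpredM ?rpredV ?rpred_nat ?rpred_int.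
  have /intrP[m Dm] := Cint_rat_Aint yQ yA.
  exists m; apply: (@intr_inj algC); by rewrite Dx Dm rmorphM /= mulrC.
by exists m%:~R; [exact: Aint_int | rewrite rmorphM /= mulrC].
Qed.

(** A nonzero algebraic integer divides the constant term [m] of its minimal polynomial, so every
    [q ^ k] would divide the nonzero integer [m]; [k = |m|] is already too large. *)
Lemma dvdA_pow_eq0 (q : nat) (x : algC) : (1 < q)%N -> x \in Aint ->
  (forall k, ((q ^ k)%N %| x)%A) -> x = 0.
Proof.
move=> q1 xA xq; apply/eqP/negPn/negP => x0.
have [p [Dp mp] dp] := minCpolyP x.
have [u [c Dpu]] : exists u c, p = u * 'X + c%:P.
  by elim/poly_ind: (p) => [|u c _]; [exists 0, 0; rewrite mul0r addr0 | exists u, c].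
have px0 : (map_poly ratr u).[x] * x + ratr c = 0.
  have /eqP <- : root (map_poly ratr p) x by rewrite dp.
  by rewrite Dpu rmorphD rmorphM /= map_polyX map_polyC /= !hornerE.
have pint i : p`_i \is a Num.int.
  rewrite -Cint_rat -(coef_map (ratr : {rmorphism rat -> algC})) -Dp.
  by apply/polyOverP; exact: xA.
have c0 : c != 0.
  apply/negP => /eqP c0; move: px0 Dpu; rewrite c0 rmorph0 !addr0 => /eqP.
  rewrite mulf_eq0 (negPf x0) orbF -/(root _ x) dp => pu Dpu.
  have p_neq0 := monic_neq0 mp.
  have u0 : u != 0 by apply: contraNneq p_neq0 => u0; rewrite Dpu u0 mul0r.
  by have := dvdp_leq u0 pu; rewrite Dpu size_mulX // ltnn.
have /intrP[m Dm] : c \is a Num.int.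
  by have := pint 0; rewrite Dpu coefD coefMX coefC /= add0r.
have uA : (map_poly ratr u).[x] \in Aint.
  rewrite horner_coef; apply: rpred_sum => i _; apply: rpredM; last by rewrite rpredX.
  rewrite coef_map /=; apply: Aint_Cint; rewrite Cint_rat.
  by have := pint i.+1; rewrite Dpu coefD coefMX coefC /= addr0.
have m0 : (0 < `|m|)%N by rewrite absz_gt0; apply: contraNneq c0 => m0; rewrite Dm m0.
have := xq `|m|%N; have qm0 : (0 < q ^ `|m|)%N by rewrite expn_gt0 (ltnW q1).
case/(dvdAP _ qm0) => y yA Dx.
have : ((q ^ `|m|)%N %| m%:~R)%A.
  rewrite -(rmorph_int (ratr : {rmorphism rat -> algC})) -Dm /=; apply/(dvdAP _ qm0).
  exists (- ((map_poly ratr u).[x] * y)); first by rewrite rpredN rpredM.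
  by move: px0; rewrite {2}Dx => /eqP; rewrite addrC addr_eq0 => /eqP ->; ring.
rewrite dvdA_int // /dvdz /= => /(dvdn_leq m0).
by rewrite leqNgt ltn_expl.
Qed.

Lemma exprD1_taylor3 (m : nat) (z : algC) : z \in Aint -> exists2 g, g \in Aint &
  (1 + z) ^+ m = 1 + m%:R * z + 'C(m, 2)%:R * z ^+ 2 + z ^+ 3 * g.
Proof.
move=> zA; elim: m => [|m [g gA IH]].
  by exists 0; rewrite ?rpred0 // expr0 bin0n /= !mul0r mulr0 !addr0.
exists ('C(m, 2)%:R + g * (1 + z)); first by rewrite rpredD ?rpredM ?rpredD ?rpred1 ?rpred_nat.
rewrite exprS IH binS bin1 natrD -natr1; ring.
Qed.

(** Induction on [j]: a [q]-th power turns [1 + q ^ j.+1 * h'] into [1 + q ^ j.+2 * h'] modulo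
    [q ^ j.+3]. At [j = 0] the quadratic term needs [q] to divide ['C(q, 2)], hence [q] odd. *)
Lemma expr_lift (q : nat) (x : algC) j m : prime q -> q != 2%N -> x \in Aint ->
  (q %| x - 1)%A ->
  ((q ^ j.+2)%N %| x ^+ (q ^ j * m) - 1 - (q ^ j * m)%:R * (x - 1))%A.
Proof.
move=> qp q2 xA /(dvdAP _ (prime_gt0 qp))[h hA Dx].
have q0 : (0 < q ^ j.+2)%N by rewrite expn_gt0 prime_gt0.
have {Dx xA} -> : x = 1 + q%:R * h by rewrite -Dx; ring.
rewrite (_ : 1 + q%:R * h - 1 = q%:R * h); last by ring.
have [g gA Dg] : exists2 g, g \in Aint &
    (1 + q%:R * h) ^+ (q ^ j) = 1 + (q ^ j.+1)%:R * h + (q ^ j.+2)%:R * g.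
  elim: j {q0} => [|j [g gA IH]]; first by exists 0; rewrite ?rpred0 // expn0 expr1 expn1 mulr0 addr0.
  set h' := h + q%:R * g.
  have hA' : h' \in Aint by rewrite rpredD ?rpredM ?rpred_nat.
  have zA : (q ^ j.+1)%:R * h' \in Aint by rewrite rpredM ?rpred_nat.
  have [u uA Du] := exprD1_taylor3 q zA.
  have [c Dc] : exists c, 'C(q, 2) = (c * q)%N.
    by apply/dvdnP; apply: prime_dvd_bin => //=; rewrite ltn_neqAle eq_sym q2 prime_gt1.
  exists (g + c%:R * (q ^ j)%:R * h' ^+ 2 + (q ^ j)%:R * (q ^ j)%:R * h' ^+ 3 * u).
    by rewrite !rpredD ?rpredM ?rpredX ?rpred_nat.
  rewrite expnSr exprM IH.
  rewrite (_ : 1 + _ + _ = 1 + (q ^ j.+1)%:R * h'); last first.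
    by rewrite /h' (expnSr q j.+1) natrM; ring.
  rewrite Du Dc /h' !expnS !natrM; ring.
set h' := h + q%:R * g.
have hA' : h' \in Aint by rewrite rpredD ?rpredM ?rpred_nat.
have zA : (q ^ j.+1)%:R * h' \in Aint by rewrite rpredM ?rpred_nat.
have [u uA Du] := exprD1_taylor3 m zA.
apply/(dvdAP _ q0).
exists (m%:R * g + 'C(m, 2)%:R * (q ^ j)%:R * h' ^+ 2
  + (q ^ j)%:R * (q ^ j)%:R * q%:R * h' ^+ 3 * u).
  by rewrite !rpredD ?rpredM ?rpredX ?rpred_nat.
rewrite exprM Dg.
rewrite (_ : 1 + _ + _ = 1 + (q ^ j.+1)%:R * h'); last first.
  by rewrite /h' (expnSr q j.+1) natrM; ring.
by rewrite Du /h' !expnS !natrM; ring.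
Qed.

Section Sequence.

Variables (r : 'I_3 -> algC) (rP : trib_roots r).
Variables (a : 'I_3 -> algC) (aA : forall i, a i \in Aint).
Variables (q N : nat) (qp : prime q) (q2 : q != 2%N).
Hypothesis rN : forall i, (q %| r i ^+ N - 1)%A.

Let L (s : int) := \sum_i a i * r i ^ s.

(** [expr_lift] applied termwise: to first order the sequence is affine in the number of steps of
    length [N], with slope [L (s + N) - L s]. *)
Lemma trib_seq_lift (s : int) j m :
  ((q ^ j.+2)%N %| L (s + (N * (q ^ j * m))%N) - L s
     - (q ^ j * m)%:R * (L (s + N) - L s))%A.
Proof.
rewrite /L -!sumrB mulr_sumr -sumrB; apply: rpred_sum => i _.
have r0 : r i \is a GRing.unit by rewrite unitfE trib_root_neq0.
rewrite !exprzDr // -!exprnP exprM.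
have -> : a i * (r i ^ s * r i ^+ N ^+ (q ^ j * m)) - a i * r i ^ s
    - (q ^ j * m)%:R * (a i * (r i ^ s * r i ^+ N) - a i * r i ^ s)
  = (r i ^+ N ^+ (q ^ j * m) - 1 - (q ^ j * m)%:R * (r i ^+ N - 1)) * (a i * r i ^ s).
  by ring.
apply: dvdA_mulr; first by rewrite rpredM // Aint_trib_rootX.
by apply: expr_lift => //; rewrite rpredX // Aint_trib_root.
Qed.

(** Each term of the second difference contains [r i ^+ N - 1] and [r i ^+ N ^+ t - 1], both
    divisible by [q]. So the slope modulo [q ^ 2] only depends on the class of [s] modulo [N]. *)
Lemma trib_seq_step (s : int) t :
  ((q ^ 2)%N %| (L (s + (N * t)%N + N) - L (s + (N * t)%N)) - (L (s + N) - L s))%A.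
Proof.
rewrite /L -!sumrB; apply: rpred_sum => i _.
have r0 : r i \is a GRing.unit by rewrite unitfE trib_root_neq0.
rewrite !exprzDr // -!exprnP exprM.
have -> : a i * (r i ^ s * r i ^+ N ^+ t * r i ^+ N) - a i * (r i ^ s * r i ^+ N ^+ t) -
  (a i * (r i ^ s * r i ^+ N) - a i * r i ^ s) =
  (r i ^+ N - 1) * (r i ^+ N ^+ t - 1) * (a i * r i ^ s) by ring.
apply: dvdA_mulr; first by rewrite rpredM // Aint_trib_rootX.
have qq := prime_gt0 qp; have rA := Aint_trib_root rP i.
case/(dvdAP _ qq): (rN i) => h hA Dh.
rewrite -{2}(expr1n algC t) subrXX Dh.
apply/(dvdAP _ _); first by rewrite expn_gt0 qq.
exists (h * (h * \sum_(k < t) (r i ^+ N) ^+ (t.-1 - k) * 1 ^+ k)); last by rewrite natrX; ring.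
rewrite !rpredM //; apply: rpred_sum => k _; by rewrite rpredM ?rpredX ?rpred1.
Qed.

End Sequence.

(** * From p-adic zeros to twisted zeros *)

Lemma prod_shift_prim_root (M : nat) (z A B : algC) : (0 < M)%N ->
  M.-primitive_root z -> \prod_(i < M) (A + B * z ^+ i) = A ^+ M - (- B) ^+ M.
Proof.
move=> M0 zM; have [->|B0] := eqVneq B 0.
  rewrite oppr0 expr0n eqn0Ngt M0 subr0 -[in RHS](card_ord M) -prodr_const.
  by apply: eq_bigr => i _; rewrite mul0r addr0.
have -> : \prod_(i < M) (A + B * z ^+ i) = \prod_(i < M) ((- B) * (A / (- B) - z ^+ i)).
  by apply: eq_bigr => i _; field.

rewrite big_split /= prodr_const card_ord.
have -> : \prod_(i < M) (A / - B - z ^+ i) = ('X^M - 1).[A / - B].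
  rewrite -(factor_Xn_sub_1 zM) big_mkord horner_prod.
  by apply: eq_bigr => i _; rewrite !hornerE.
rewrite !hornerE expr_div_n mulrBr mulr1; congr (_ - _).
by rewrite mulrC divfK // expf_neq0 // oppr_eq0.
Qed.

Lemma dvdA_prodB (e : nat) (I : finType) (F G : I -> algC) : (0 < e)%N ->
  (forall i, F i \in Aint) -> (forall i, G i \in Aint) ->
  (forall i, (e %| F i - G i)%A) -> (e %| \prod_i F i - \prod_i G i)%A.
Proof.
move=> e0 FA GA FG.
pose P x y := [/\ x \in Aint, y \in Aint & (e %| x - y)%A].
suff [] : P (\prod_i F i) (\prod_i G i) by [].
apply: (big_rec2 P) => [|i x y _ [xA yA xy]].
  by split; rewrite ?rpred1 // subrr rpred0.
split; rewrite ?rpredM //.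
have -> : F i * x - G i * y = (x - y) * F i + (F i - G i) * y by ring.
by rewrite rpredD // dvdA_mulr.
Qed.

Section Twist.

Variables (M : nat) (z : algC) (M0 : (0 < M)%N) (zM : M.-primitive_root z).

Let zA i : z ^+ i \in Aint.
Proof. by rewrite rpredX // (Aint_prim_root zM). Qed.

(* [F] only depends on the [M]-th powers of its arguments, so that congruent
   powers give congruent values. *)
Let F (x0 x1 x2 : algC) :=
  \prod_(i < M) \prod_(j < M) \prod_(k < M) (x2 * z ^+ i + x1 * z ^+ j + x0 * z ^+ k).

Lemma twist_prod_swap01 x0 x1 x2 : F x0 x1 x2 = F x1 x0 x2.
Proof.
rewrite /F; apply: eq_bigr => i _; rewrite exchange_big /=.
by apply: eq_bigr => j _; apply: eq_bigr => k _; rewrite addrAC.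
Qed.

Lemma twist_prod_swap12 x0 x1 x2 : F x0 x1 x2 = F x0 x2 x1.
Proof.
rewrite /F exchange_big /=.
by do 3!(apply: eq_bigr => ? _); rewrite (addrC (_ * _) (_ * _)).
Qed.

Lemma twist_prod_congr (e : nat) x x' x1 x2 : (0 < e)%N ->
  [/\ x \in Aint, x' \in Aint, x1 \in Aint & x2 \in Aint] ->
  (e %| x ^+ M - x' ^+ M)%A -> (e %| F x x1 x2 - F x' x1 x2)%A.
Proof.
move=> e0 [xA xA' x1A x2A] xx'.
have lA y : y \in Aint -> forall i j k : 'I_M,
    x2 * z ^+ i + x1 * z ^+ j + y * z ^+ k \in Aint.
  by move=> yA i j k; rewrite !rpredD ?rpredM.
apply: dvdA_prodB => // [i|i|i]; try by do 2!(apply: rpred_prod => ? _); exact: lA.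
apply: dvdA_prodB => // [j|j|j]; try by apply: rpred_prod => ? _; exact: lA.
rewrite !(prod_shift_prim_root _ _ M0 zM).
rewrite opprB addrC addrA subrK.
rewrite -(mulN1r x) -(mulN1r x') !exprMn -mulrBr mulrC dvdA_mulr //.
  by rewrite rpredX // rpredN rpred1.
by rewrite -opprB rpredN.
Qed.

(** The arguments are exchanged one at a time, the symmetries of [F] bringing the exchanged one to
    the first place. In the end [F] at [y] is divisible because its factor at [i = j = k = 0] is the
    sum of the [y i]. *)
Lemma twist_prod_dvd (e : nat) (x y : 'I_3 -> algC) : (0 < e)%N ->
  (forall i, x i \in Aint) -> (forall i, y i \in Aint) ->
  (forall i, (e %| x i ^+ M - y i ^+ M)%A) -> (e %| \sum_i y i)%A ->
  (e %| F (x 0) (x 1) (x 2%:R))%A.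
Proof.
move=> e0 xA yA xy ye.
have -> : F (x 0) (x 1) (x 2%:R) =
    (F (x 0) (x 1) (x 2%:R) - F (y 0) (x 1) (x 2%:R))
  + (F (x 1) (y 0) (x 2%:R) - F (y 1) (y 0) (x 2%:R))
  + (F (x 2%:R) (y 0) (y 1) - F (y 2%:R) (y 0) (y 1))
  + F (y 0) (y 1) (y 2%:R).
  rewrite (twist_prod_swap01 (x 1)) (twist_prod_swap01 (y 1)).
  rewrite (twist_prod_swap01 (x 2%:R)) (twist_prod_swap01 (y 2%:R)).
  rewrite (twist_prod_swap12 _ (x 2%:R)) (twist_prod_swap12 _ (y 2%:R)); ring.
apply: rpredD; [apply: rpredD; [apply: rpredD|]|]; try by apply: twist_prod_congr.
rewrite /F (bigD1 (Ordinal M0)) //= dvdA_mulr //.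
  by do 3!(apply: rpred_prod => ? _); rewrite !rpredD ?rpredM.
rewrite (bigD1 (Ordinal M0)) //= dvdA_mulr //.
  by do 2!(apply: rpred_prod => ? _); rewrite !rpredD ?rpredM.
rewrite (bigD1 (Ordinal M0)) //= dvdA_mulr //.
  by apply: rpred_prod => ? _; rewrite !rpredD ?rpredM.
rewrite /= !expr0 !mulr1 (_ : _ + _ + _ = \sum_i y i) //.
by rewrite sum3; ring.
Qed.

End Twist.

(** The product of all twisted sums is an algebraic integer divisible by every power of [q], hence
    0, so one twisted sum vanishes. This turns a [q]-adic zero into a relation over [algC]. *)
Lemma twisted_zero_of_padic (q M : nat) (x : 'I_3 -> algC) :
  (1 < q)%N -> (0 < M)%N -> (forall i, x i \in Aint) ->
  (forall k, exists y : 'I_3 -> algC, [/\ forall i, y i \in Aint,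
     forall i, ((q ^ k)%N %| x i ^+ M - y i ^+ M)%A & ((q ^ k)%N %| \sum_i y i)%A]) ->
  exists2 t : 'I_3 -> algC, forall i, t i ^+ M = 1 & \sum_i x i * t i = 0.
Proof.
move=> q1 M0 xA xy; have [z zM] := C_prim_root_exists M0.
have zA i : z ^+ i \in Aint by rewrite rpredX // (Aint_prim_root zM).
have /eqP : \prod_(i < M) \prod_(j < M) \prod_(k < M)
    (x 2%:R * z ^+ i + x 1 * z ^+ j + x 0 * z ^+ k) = 0.
  apply: (@dvdA_pow_eq0 q) => // [|k].
    by do 3!(apply: rpred_prod => ? _); rewrite !rpredD ?rpredM.
  have [y [yA yM yk]] := xy k.
  by apply: (twist_prod_dvd M0 zM _ xA yA) => //; rewrite expn_gt0 ltnW.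
case/prodf_eq0 => i _ /prodf_eq0[j _ /prodf_eq0[k _ /eqP e]].
(* The outermost index [i] goes with [x 2], hence the reversed list. *)
exists (fun l : 'I_3 => z ^+ nth 0%N [:: (k : nat); (j : nat); (i : nat)] l).
  by move=> l; rewrite exprAC (prim_expr_order zM) expr1n.
by rewrite sum3 /= -e; ring.
Qed.

(** * Automorphisms of the algebraic numbers *)

(** The splitting field of [minCpoly x] is normal over the rationals, so its Galois group is
    transitive on the conjugates of [x], and its elements extend to [algC]. *)
Lemma aut_minCpoly (x y : algC) : root (minCpoly x) y ->
  exists nu : {rmorphism algC -> algC}, nu x = y.
Proof.
move=> rxy.
have [p [Dp mp] dp] := minCpolyP x.
have [s Ds] := closed_field_poly_normal (minCpoly x).
rewrite (monicP (minCpoly_monic x)) scale1r in Ds.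
have [Qs [QsC [s1 Ds1 genQs]]] := num_field_exists s.
pose P := map_poly (in_alg Qs) p.
have QsCin (q : {poly rat}) : map_poly QsC (map_poly (in_alg Qs) q) = map_poly ratr q.
  rewrite -map_poly_comp; apply: eq_map_poly => a /=.
  by rewrite alg_num_field fmorph_rat.
have DP : P = \prod_(a <- s1) ('X - a%:P).
  apply: (map_poly_inj QsC); rewrite QsCin -Dp Ds -Ds1 big_map rmorph_prod /=.
  by apply: eq_bigr => a _; rewrite map_polyXsubC.
have splitP : splittingFieldFor 1 P {:Qs}.
  by exists s1; rewrite // -DP eqpxx.
have PQ : P \is a polyOver 1%AS.
  by apply/polyOverP => i; rewrite coef_map /= memvZ ?mem1v.
have Qs_ax : FieldExt_isSplittingField _ Qs by constructor; exists P.
pose Qn : splittingFieldType rat := HB.pack Qs Qs_ax.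
have mem_s a : root (minCpoly x) a -> exists2 b : Qn, b \in s1 & a = QsC b.
  by rewrite Ds root_prod_XsubC -Ds1 => /mapP.
have [x1 _ Dx] := mem_s x (root_minCpoly x).
have [y1 _ Dy] := mem_s y rxy.
have r1 : root (minPoly 1%AS x1) y1.
  have aP i : (minPoly 1%AS x1)`_i \in 1%VS by apply/polyOverP; apply: minPolyOver.
  have a_ i := sig_eqW (vlineP _ _ (aP i)).
  have [q Dq] : exists q, minPoly 1%AS x1 = map_poly (in_alg Qn) q.
    exists (\poly_(i < size (minPoly 1 x1)) sval (a_ i)).
    apply/polyP=> i; rewrite coef_map coef_poly /=.
    case: ltnP => [_ | hi]; first by case: (a_ i).
    by rewrite nth_default //= scale0r.
  have := root_minPoly 1%AS x1.
  rewrite Dq -!(fmorph_root QsC) QsCin -Dx -Dy dp => /dvdpP[u ->].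
  by rewrite rmorphM /= rootM -Dp rxy orbT.
have [g _ Dg] := normalField_root_minPoly (sub1v _) (normalFieldf 1%AS) (memvf x1) r1.
have [nu Dnu] := extend_algC_subfield_aut QsC (gal_repr g : {rmorphism Qn -> Qn}).
by exists nu; rewrite Dx -Dnu Dy; congr (QsC _).
Qed.

(** All roots of the minimal polynomial equal [x], so its next-to-leading coefficient is minus a
    positive multiple of [x]. *)
Lemma aut_fixed_Crat (x : algC) :
  (forall nu : {rmorphism algC -> algC}, nu x = x) -> x \in Crat.
Proof.
move=> fx.
have [p [Dp mp] dp] := minCpolyP x.
have [s Ds] := closed_field_poly_normal (minCpoly x).
rewrite (monicP (minCpoly_monic x)) scale1r in Ds.
have sx a : a \in s -> a = x.
  rewrite -root_prod_XsubC -Ds => /aut_minCpoly[nu <-]; exact: fx.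
have s0 : size s != 0.
  by apply/eqP=> s0; have := size_minCpoly x; rewrite Ds size_prod_XsubC s0.
have : (minCpoly x)`_(size s).-1 \in Crat by rewrite Dp coef_map Crat_rat.
rewrite Ds coefPn_prod_XsubC // rpredN (eq_big_seq (fun=> x)) => [|a /sx //].
rewrite big_const_seq count_predT iter_addr_0 => sxQ.
rewrite -(mulfK (_ : (size s)%:R != 0) x) ?pnatr_eq0 // mulr_natr.
by rewrite rpredM // rpredV rpred_nat.
Qed.

Lemma tribpoly_rat_irreducible : irreducible_poly (tribpoly rat).
Proof.
apply: cubic_irreducible => [|x]; first by rewrite size_tribpoly.
apply/negP => /eqP; rewrite horner_tribpoly => x0.
have /intrP[m Dm] : (ratr x : algC) \in Num.int.
  apply: Cint_rat_Aint; first exact: Crat_rat.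
  apply: (@root_monic_Aint (tribpoly algC)); last 2 first.
  - exact: monic_tribpoly.
  - by apply/polyOverP=> k; rewrite -(map_tribpoly (intr : int -> algC)) coef_map intr_int.
  rewrite /root horner_tribpoly -!rmorphXn /= -!rmorphB /=.
  by rewrite -(rmorph1 (ratr : {rmorphism rat -> algC})) -rmorphB x0 rmorph0.
have Dx : x = m%:~R.
  by apply: (fmorph_inj (ratr : {rmorphism rat -> algC})); rewrite /= Dm rmorph_int.
have : m * (m ^+ 2 - m - 1) = 1.
  apply: (@intr_inj rat); move: x0; rewrite Dx !(rmorphM, rmorphB, rmorphXn) /= => x0.
  rewrite rmorph1; by rewrite -[RHS]addr0 -x0; ring.
move=> mE; have /eqP := congr1 absz mE; rewrite abszM muln_eq1 => /andP[/eqP m1 _].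
by move: mE; case: m m1 {Dm Dx} => [[|[|n]]|[|n]] //.
Qed.

(** The negative discriminant prevents all roots from being real. So conjugation exchanges two of
    them and fixes the third, which is numbered 0. *)
Lemma roots_numbering_exists : exists r : 'I_3 -> algC,
  [/\ trib_roots r, (r 0)^* = r 0, (r 1)^* = r 2%:R & (r 2%:R)^* = r 1].
Proof.
have [r rP] := trib_roots_exist.
have rJ i : exists j, (r i)^* = r j.
  apply/(root_tribP rP); rewrite -(map_tribpoly (Num.conj : {rmorphism algC -> algC})).
  by rewrite fmorph_root; apply/(root_tribP rP); exists i.
have [a [b [ab Da]]] : exists a b, a <> b /\ (r a)^* = r b.
  have [real_r|] := boolP [forall i, (r i)^* == r i]; last first.
    case/forallPn => a ra; have [b Db] := rJ a; exists a, b; split=> // Dab.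
    by rewrite Db Dab eqxx in ra.
  have rR i : r i \is Num.real by rewrite CrealE; apply: (forallP real_r).
  have : 0 <= ((r 0 - r 1) * (r 1 - r 2%:R) * (r 2%:R - r 0)) ^+ 2.
    by rewrite real_exprn_even_ge0 // !realM ?realB.
  by rewrite (trib_roots_disc rP) oppr_ge0 lern0.
have Db : (r b)^* = r a by rewrite -Da conjCK.
have [f [fa fb cov]] : exists f, [/\ f != a, f != b & forall i, [|| i == f, i == a | i == b]].
  pose cv f := [&& f != a, f != b & [forall i, [|| i == f, i == a | i == b]]].
  suff [f /and3P[? ? /forallP ?]] : exists f, cv f by exists f.
  apply/existsP; move: ab => /eqP; rewrite /cv; move: a b {Da Db cv}.
  have all3 (P : pred 'I_3) : [forall i, P i] = [&& P 0, P 1 & P 2%:R].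
    apply/forallP/and3P => [h|[? ? ?]]; [by split | exact: ord3P].
  have ex3 (P : pred 'I_3) : [exists i, P i] = [|| P 0, P 1 | P 2%:R].
    by rewrite -[LHS]negbK negb_exists all3 !negb_and !negbK.
  by apply: ord3P; apply: ord3P; rewrite ex3 !all3.
have Df : (r f)^* = r f.
  have [g Dg] := rJ f; rewrite Dg; congr r; apply/eqP.
  have inj := trib_roots_inj rP.
  have := cov g; case/or3P => // /eqP Dg'; rewrite Dg' in Dg.
    have /inj E : r f = r b by rewrite -Da -Dg conjCK.
    by rewrite E eqxx in fb.
  have /inj E : r f = r a by rewrite -Db -Dg conjCK.
  by rewrite E eqxx in fa.
pose s (i : 'I_3) := nth f [:: f; a; b] i.
have s_inj : injective s.
  have fa' : f <> a by apply/eqP. have fb' : f <> b by apply/eqP.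
  by apply: ord3P; apply: ord3P => //= E; try (by case: ab); try (by case: fa'); try (by case: fb').
exists (r \o s); split=> //.
by rewrite /trib_roots rP (reindex_inj s_inj).
Qed.

Lemma derangement3 (x y z : 'I_3) :
  [&& x != 0, y != 1, z != 2%:R, x != y, x != z & y != z] ->
  [&& x == 1, y == 2%:R & z == 0] || [&& x == 2%:R, y == 0 & z == 1].
Proof. by move: x; apply: ord3P; move: y; apply: ord3P; move: z; apply: ord3P. Qed.

(** * Galois action on the roots and on roots of unity *)

Section Galois.

Variables (r : 'I_3 -> algC) (rP : trib_roots r).

Lemma trib_roots_trans i j : exists nu : {rmorphism algC -> algC}, nu (r i) = r j.
Proof.
apply: aut_minCpoly; have [p [Dp mp] dp] := minCpolyP (r i).
have rat_root k : root (map_poly ratr (tribpoly rat)) (r k).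
  by rewrite map_tribpoly; apply/(root_tribP rP); exists k.
have pT : p %| tribpoly rat by rewrite -dp.
have szp : size p != 1%N.
  by have := size_minCpoly (r i); rewrite Dp size_map_poly neq_ltn => ->; rewrite orbT.
have := tribpoly_rat_irreducible.2 p szp pT => /eqpP[[c d] /= /andP[c0 d0] E].
have := rat_root j; rewrite Dp /root => /eqP h.
have : (map_poly ratr (c *: p)).[r j] = 0 :> algC.
  by rewrite E map_polyZ hornerZ h mulr0.
rewrite map_polyZ hornerZ => /eqP; rewrite mulf_eq0 fmorph_eq0 (negPf c0) /=.
by [].
Qed.

Lemma aut_perm (nu : {rmorphism algC -> algC}) :
  exists s : {perm 'I_3}, forall i, nu (r i) = r (s i).
Proof.
have rJ i : exists j, nu (r i) == r j.
  have [j ->] : exists j, nu (r i) = r j; last by exists j.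
  apply/(root_tribP rP); rewrite -(map_tribpoly nu).
  by rewrite fmorph_root; apply/(root_tribP rP); exists i.
pose f i := xchoose (rJ i).
have fE i : nu (r i) = r (f i) by apply/eqP; exact: (xchooseP (rJ i)).
have f_inj : injective f.
  by move=> i j E; apply: (trib_roots_inj rP); apply: (fmorph_inj nu); rewrite !fE E.
by exists (perm f_inj) => i; rewrite permE.
Qed.

Hypotheses (r0J : (r 0)^* = r 0) (r1J : (r 1)^* = r 2%:R) (r2J : (r 2%:R)^* = r 1).

(** On [n]-th roots of unity an automorphism is a power map, so any two automorphisms commute
    there. *)
Lemma aut_unity (nu : {rmorphism algC -> algC}) n : (0 < n)%N ->
  exists k, forall z, z ^+ n = 1 -> nu z = z ^+ k.
Proof.
move=> n0; have [z zn] := C_prim_root_exists n0.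
have /(prim_rootP zn)[k Dk] : nu z ^+ n = 1.
  by rewrite -rmorphXn (prim_expr_order zn) rmorph1.
exists k => _ /(prim_rootP zn)[i ->].
by rewrite rmorphXn Dk exprAC.
Qed.

(** Taken as the commutator of conjugation with some [sg] sending [r 0] to [r 1]. It is trivial on
    roots of unity, where automorphisms commute; on the [r i] it is a product of two distinct
    transpositions, one fixing [r 1] and one fixing [r 0], hence a 3-cycle. *)
Lemma aut_cycle : exists nu : {rmorphism algC -> algC},
  (forall i, nu (r i) = r (i + 1)) /\
  (forall n z, (0 < n)%N -> z ^+ n = 1 -> nu z = z).
Proof.
have [sg Dsg] := trib_roots_trans 0 1.
pose sV : {rmorphism algC -> algC} := algC_invaut sg.
pose c : {rmorphism algC -> algC} := Num.conj.
pose k : {rmorphism algC -> algC} := (sg \o (c \o (sV \o c)))%FUN.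
have kE x : k x = sg ((sV x^*)^*) by [].
have k_unity n z : (0 < n)%N -> z ^+ n = 1 -> k z = z.
  move=> n0 zn; rewrite kE.
  have [a Da] := aut_unity sV n0; have [b Db] := aut_unity c n0.
  have Ec (x : algC) : x ^+ n = 1 -> x^* = x ^+ b by move=> xn; rewrite -(Db _ xn).
  have E : sV z^* = (sV z)^*.
    have h : sV z ^+ n = 1 by rewrite -rmorphXn zn rmorph1.
    by rewrite (Ec _ zn) (Ec _ h) rmorphXn.
  by rewrite E conjCK algC_invautK.
have [s Ds] := aut_perm sV; have [p Dp] := aut_perm k.
have s1 : s 1 = 0.
  by apply: (trib_roots_inj rP); rewrite -Ds -Dsg; exact: algC_autK.
(* In this numbering conjugation negates the index modulo 3. *)
have cE i : (r i)^* = r (- i).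
  move: i; apply: ord3P; rewrite ?oppr0 ?r0J //.
    by rewrite r1J; congr r; apply: val_inj.
  by rewrite r2J; congr r; apply: val_inj.
have pE i : s (p i) = - s (- i).
  by apply: (trib_roots_inj rP); rewrite -Ds -Dp kE cE Ds cE; exact: algC_autK.
have p_fix i : p i <> i.
  move=> pfix; have := pE i; rewrite pfix; move: i {pfix}; apply: ord3P.
  - by rewrite oppr0; move: (s 0) (@perm_inj _ s 0 1); rewrite s1;
      apply: ord3P => // h _; have := h (erefl _).
  - rewrite s1 => /esym/eqP; rewrite oppr_eq0 -s1 => /eqP/perm_inj.
    by move/(congr1 val).
  - rewrite (_ : - 2%:R = 1) ?s1 ?oppr0; last exact: val_inj.
    by rewrite -s1 => /perm_inj/(congr1 val).
have p_shift : (forall i, p i = i + 1) \/ (forall i, p i = i - 1).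
  have : [&& p 0 != 0, p 1 != 1, p 2%:R != 2%:R, p 0 != p 1, p 0 != p 2%:R & p 1 != p 2%:R].
    by rewrite !(inj_eq perm_inj) !(introN eqP (p_fix _)).
  case/derangement3/orP => /and3P[/eqP p0 /eqP p1 /eqP p2]; [left | right];
    by apply: ord3P; rewrite ?p0 ?p1 ?p2; apply: val_inj.
case: p_shift => ps; first by exists k; split=> [i|//]; rewrite Dp ps.
(* Here [k] is the opposite cycle, so its square is the wanted one. *)
exists (k \o k)%FUN; split=> [i|n z n0 zn]; last first.
  by have e := k_unity n z n0 zn; exact: etrans (congr1 k e) e.
rewrite (_ : _ (r i) = k (k (r i))) // !Dp !ps; congr r.
by move: i; apply: ord3P; apply: val_inj.
Qed.

End Galois.

(** * Twisted zeros *)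

Lemma tribonacci_constant_bounds (R : realFieldType) (b : R) :
  0 < b -> b ^+ 3 = b ^+ 2 + b + 1 -> 1 < b /\ b < 184%:R / 100%:R.
Proof.
move=> b0 bE; split; rewrite ltNge; apply/negP => h.
  have : b ^+ 3 <= b ^+ 2 by rewrite ler_wiXn2l // ltW.
  lra.
have h2 : 0 <= (b - 184%:R / 100%:R) * b by rewrite mulr_ge0 ?subr_ge0 // ltW.
have h3 : 0 <= (b - 184%:R / 100%:R) * b ^+ 2 by rewrite mulr_ge0 ?subr_ge0 // exprn_ge0 // ltW.
rewrite mulrBl -expr2 in h2; rewrite mulrBl -exprS in h3.
lra.
Qed.

Lemma int_no_gap (k e : int) : k < e -> e < k + 1 -> False.
Proof. lia. Qed.

Lemma int_lt4 (e : int) : -1 < e -> e < 4 -> [\/ e = 0, e = 1, e = 2 | e = 3].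
Proof.
move=> e1 e4; have : e = 0 \/ e = 1 \/ e = 2 \/ e = 3 by lia.
by case=> [->|[->|[->|->]]]; [constructor 1 | constructor 2 | constructor 3 | constructor 4].
Qed.

(* [x] is the real conjugate of an [m]-th root of [b], while [t] and [p] are the
   sum and the product of its complex conjugates. When [1 < m] the bounds only
   leave the polynomial [X^3 - X - 1], whose real root is not a root of [b]. *)
Lemma unit_not_power (R : realFieldType) (b x t p : R) (m : nat) (e1 e2 : int) :
  0 < b -> b ^+ 3 = b ^+ 2 + b + 1 -> 0 < x -> x ^+ m = b -> x * p = 1 ->
  t ^+ 2 <= 4%:R * p -> x + t = e1%:~R -> x * t + p = e2%:~R -> (m <= 1)%N.
Proof.
move=> b0 bE x0 xm xp tp te1 te2; rewrite leqNgt; apply/negP => m1.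
have [b1 b2] := tribonacci_constant_bounds b0 bE.
have x1 : 1 < x.
  rewrite ltNge; apply/negP => xle1.
  have := exprn_ile1 m (ltW x0) xle1; rewrite xm; lra.
have x2b : x ^+ 2 <= b by rewrite -xm ler_weXn2l // ltW.
have b184 : x ^+ 2 < 184%:R / 100%:R by apply: le_lt_trans b2.
have y0 : 0 < x - 1 by rewrite subr_gt0.
(* [1.36 ^ 2 = 1.8496] exceeds 1.84, and [0.73 * 1.36 < 1] gives the next bound. *)
have x3 : x < 136%:R / 100%:R.
  rewrite ltNge; apply/negP => h.
  have h2 : 0 <= (x - 136%:R / 100%:R) * (x + 136%:R / 100%:R) by rewrite mulr_ge0 ?subr_ge0 //; lra.
  lra.
have p0 : 73%:R / 100%:R < p.
  rewrite ltNge; apply/negP => h.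
  have h2 : 0 <= x * (73%:R / 100%:R - p) by rewrite mulr_ge0 ?subr_ge0 // ltW.
  lra.
have p1 : p < 1.
  rewrite ltNge; apply/negP => h.
  have h2 : 0 <= x * (p - 1) by rewrite mulr_ge0 ?subr_ge0 // ltW.
  lra.
have t1 : t < 2%:R.
  rewrite ltNge; apply/negP => h.
  have h2 : 0 <= (t - 2%:R) * (t + 2%:R) by rewrite mulr_ge0 ?subr_ge0 //; lra.
  lra.
have t2 : - 2%:R < t.
  rewrite ltNge; apply/negP => h.
  have h2 : 0 <= (- t - 2%:R) * (2%:R - t) by rewrite mulr_ge0 //; lra.
  lra.
have yy : 0 < (x - 1) * (x - 1) by rewrite mulr_gt0.
have yyy : 0 < (x - 1) * (x - 1) * (x - 1) by rewrite !mulr_gt0.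
have y2 : 0 < (x - 1) * (136%:R / 100%:R - x) by rewrite mulr_gt0 // subr_gt0.
have tE : t = e1%:~R - x by rewrite -te1; ring.
have e2E : x * (e1%:~R - x) + p = e2%:~R by rewrite -tE.
have e1l : -1 < e1 by rewrite -(ltr_int R) -te1; clear -x1 t2; lra.
have e1u : e1 < 4 by rewrite -(ltr_int R) -te1; clear -x3 t1; lra.
have no_int (k : int) : (k%:~R < (e2%:~R : R)) -> (e2%:~R < (k + 1)%:~R :> R) -> False.
  by rewrite !ltr_int; apply: int_no_gap.
(* For [e1 = 1, 2, 3] the bounds put [e2] strictly between [e1 - 1] and [e1]. For [e1 = 0] they
   force [e2 = -1], that is [x ^+ 3 = x + 1]. *)
case: (int_lt4 e1l e1u) => e1E; rewrite {}e1E in e2E; clear e1l e1u te1 te2 tE t1 t2 tp.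
- have e2l : -2 < e2 by rewrite -(ltr_int R) -e2E; lra.
  have e2u : e2 < 0 by rewrite -(ltr_int R) -e2E; lra.
  have e2m1 : e2 = -1 by move: e2l e2u; clear; lia.
  rewrite e2m1 in e2E.
  have x3E : x ^+ 3 = x + 1.
    have : x * (x * (0 - x) + p) = x * (-1) by rewrite e2E.
    by rewrite mulrDr xp; lra.
  (* If [m = 2], the equation of [b = x ^+ 2] reduces to [x ^+ 2 = x]; if [m >= 3], then
     [x + 1 = x ^+ 3 <= b < 2] although [x > 1]. *)
  have [m2|m3] : m = 2 \/ (3 <= m)%N by move: m1; clear; case: m => [|[|[|m]]]; auto.
    have D : b = x ^+ 2 by rewrite -xm m2.
    have E6 : x ^+ 6 = (x + 1) ^+ 2 by rewrite -x3E -exprM.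
    have E4 : x ^+ 4 = x ^+ 2 + x by rewrite exprS x3E; ring.
    move: bE; rewrite D -!exprM E6 E4 => bE.
    lra.
  have : x ^+ 3 <= b by rewrite -xm ler_weXn2l // ltW.
  rewrite x3E; lra.
- apply: (no_int 0); rewrite -e2E; last lra.
  rewrite -(pmulr_rgt0 _ x0) mulrDr xp.
  have h : 0 < (184%:R / 100%:R - x ^+ 2) * (x - 1) by rewrite mulr_gt0 // subr_gt0.
  lra.
- by apply: (no_int 1); rewrite -e2E; lra.
- apply: (no_int 2); rewrite -e2E; first lra.
  rewrite -subr_gt0 -(pmulr_rgt0 _ x0).
  lra.
Qed.

Lemma Aint_expr (n : nat) (x : algC) : (0 < n)%N -> x ^+ n \in Aint -> x \in Aint.
Proof.
move=> n0 xA; apply: (@root_monic_Aint (minCpoly (x ^+ n) \Po 'X^n)).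
- by rewrite /root horner_comp !hornerE; apply: root_minCpoly.
- rewrite monicE lead_coef_comp ?size_polyXn // lead_coefXn expr1n mulr1.
  exact: minCpoly_monic.
- by rewrite polyOver_comp // rpredX // polyOverX.
Qed.

(** Such numbers form an equilateral triangle centred at 0. Algebraically, clearing conjugates in
    the norm equations gives [a ^+ 2 + a * b + b ^+ 2 = 0]. *)
Lemma cube_of_equal_norms (a b c : algC) : a != 0 -> a + b + c = 0 ->
  `|a| = `|b| -> `|b| = `|c| -> a ^+ 3 = a * b * c.
Proof.
move=> a0 abc ab bc; have b0 : b != 0 by rewrite -normr_eq0 -ab normr_eq0.
have Dc : c = - (a + b) by apply/eqP; rewrite -addr_eq0 addrC abc.
have na : a * a^* = `|a| ^+ 2 by rewrite normCK.
have nb : b * b^* = `|a| ^+ 2 by rewrite ab normCK.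
have nc : (a + b) * (a^* + b^*) = `|a| ^+ 2.
  by rewrite -rmorphD /= -normCK ab bc Dc normrN.
have E : `|a| ^+ 2 * (a ^+ 2 + a * b + b ^+ 2) = 0.
  move: na nb nc; set u := a^*; set v := b^*; set n := `|a| ^+ 2 => na nb nc.
  have -> : n * (a ^+ 2 + a * b + b ^+ 2) = a * b * ((a + b) * (u + v) - n)
      - a * b * (a * u - n) - a * b * (b * v - n) - a ^+ 2 * (b * v - n)
      - b ^+ 2 * (a * u - n) by ring.
  by rewrite na nb nc (subrr n) !mulr0 !subr0.
have {}E : a ^+ 2 + a * b + b ^+ 2 = 0.
  by move/eqP: E; rewrite mulf_eq0 sqrf_eq0 normr_eq0 (negPf a0) => /eqP.
rewrite Dc (_ : a * b * _ = a ^+ 3 - a * (a ^+ 2 + a * b + b ^+ 2)); last by ring.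
by rewrite E mulr0 subr0.
Qed.

(** * Linear relations with roots of unity as coefficients *)

Section Twisted.

Variables (r : 'I_3 -> algC) (rP : trib_roots r).
Hypotheses (r0J : (r 0)^* = r 0) (r1J : (r 1)^* = r 2%:R) (r2J : (r 2%:R)^* = r 1).

Lemma aut_binet_coef (nu : {rmorphism algC -> algC}) x :
  nu (binet_coef x) = binet_coef (nu x).
Proof. by rewrite /binet_coef !(rmorphB, rmorphXn, rmorphM) /= !rmorph_nat. Qed.

Variables (w : 'I_3 -> algC) (M : nat) (B : int) (M0 : (0 < M)%N).
Hypotheses (wM : forall i, w i ^+ M = r i ^ B)
           (sum0 : \sum_i binet_coef (r i) * w i = 0).

Let y i := binet_coef (r i) * w i.

Lemma weight_neq0 i : w i != 0.
Proof.
have : w i ^+ M != 0 by rewrite wM expfz_neq0 // trib_root_neq0.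
by rewrite expf_eq0 M0.
Qed.

Let y_neq0 i : y i != 0.
Proof. by rewrite mulf_neq0 ?weight_neq0 // binet_coef_neq0. Qed.

Let succ3 (i : 'I_3) : i + 1 + 1 + 1 = i.
Proof. by move: i; apply: ord3P; apply: val_inj. Qed.

Let sum_cyc (f : 'I_3 -> algC) i : \sum_j f j = f i + f (i + 1) + f (i + 1 + 1).
Proof.
have e0 : (0 + 1 : 'I_3) = 1 by apply: val_inj.
have e1 : (1 + 1 : 'I_3) = 2%:R by apply: val_inj.
have e2 : (2%:R + 1 : 'I_3) = 0 by apply: val_inj.
by rewrite sum3; move: i; apply: ord3P; rewrite ?(e0, e1, e2) //; ring.
Qed.

Let prod_cyc (f : 'I_3 -> algC) i : \prod_j f j = f i * f (i + 1) * f (i + 1 + 1).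
Proof.
have e0 : (0 + 1 : 'I_3) = 1 by apply: val_inj.
have e1 : (1 + 1 : 'I_3) = 2%:R by apply: val_inj.
have e2 : (2%:R + 1 : 'I_3) = 0 by apply: val_inj.
by rewrite prod3; move: i; apply: ord3P; rewrite ?(e0, e1, e2) //; ring.
Qed.

Lemma aut_weight_expr (nu : {rmorphism algC -> algC}) (s : 'I_3 -> 'I_3) i :
  nu (r i) = r (s i) -> nu (w i) ^+ M = w (s i) ^+ M.
Proof. by move=> ri; rewrite -rmorphXn !wM /= fmorphXz ri. Qed.

Lemma prod_weight_expr : (\prod_i w i) ^+ M = 1.
Proof.
rewrite -prodrXl (eq_bigr (fun i => r i ^ B)) => [|i _]; last exact: wM.
by rewrite prod3 -!expfzMl -(prod3 r) prod_trib_roots // exp1rz.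
Qed.

Lemma Aint_weight i : w i \in Aint.
Proof. by apply: (Aint_expr M0); rewrite wM Aint_trib_rootX. Qed.

(* Were the [t i] not all equal, the ratios of the [y i] would be ratios of
   differences of roots of unity, hence fixed by an automorphism that permutes
   the [y i] cyclically up to roots of unity; this makes the [y i] equal in
   norm, so that all [y i ^+ 3] agree and [P'(r i) ^+ 3 / 44] is integral. *)
Lemma unity_relation_trivial (n : nat) (t : 'I_3 -> algC) : (0 < n)%N ->
  (forall i, t i ^+ n = 1) -> \sum_i t i * y i = 0 -> forall i j, t i = t j.
Proof.
move=> n0 tn sumt0.
have [k [kr k1]] := aut_cycle rP r0J r1J r2J.
have kt i : k (t i) = t i by apply: k1 n0 (tn i).
have sumt0' i : t i * y i + t (i + 1) * y (i + 1) + t (i + 1 + 1) * y (i + 1 + 1) = 0.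
  by rewrite -(sum_cyc (fun j => t j * y j)).
have sumy i : y i + y (i + 1) + y (i + 1 + 1) = 0 by rewrite -sum_cyc.
(* The third term is eliminated between the twisted and the untwisted relation. *)
have rel i : (t i - t (i + 1 + 1)) * y i = (t (i + 1 + 1) - t (i + 1)) * y (i + 1).
  apply/eqP; rewrite -subr_eq0; apply/eqP.
  transitivity (t i * y i + t (i + 1) * y (i + 1) + t (i + 1 + 1) * y (i + 1 + 1)
    - t (i + 1 + 1) * (y i + y (i + 1) + y (i + 1 + 1))); first by ring.
  by rewrite sumt0' sumy mulr0 subr0.
have [[i tiN]|teq] : (exists i, t i = t (i + 1 + 1)) \/ forall i, t i != t (i + 1 + 1).
  have [/existsP[i /eqP ?]|/existsPn h] := boolP [exists i, t i == t (i + 1 + 1)].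
    by left; exists i.
  by right=> i; exact: h.
  have t2 : t (i + 1 + 1) = t (i + 1).
    have /esym/eqP := rel i; rewrite tiN subrr mul0r mulf_eq0 (negPf (y_neq0 _)) orbF.
    by rewrite subr_eq0 => /eqP.
  suff h j : t j = t i by move=> a b; rewrite !h.
  have : (j == i) || (j == i + 1) || (j == i + 1 + 1).
    by move: i j {tiN t2}; apply: ord3P; apply: ord3P.
  by case/orP => [/orP[]|] /eqP ->; rewrite // -?t2 -tiN.
have knorm i : `|k (y i)| = `|y (i + 1)|.
  rewrite /y rmorphM aut_binet_coef kr !normrM; congr (_ * _).
  apply/eqP; rewrite -(@eqrXn2 _ M) ?normr_ge0 // -!normrX.
  by rewrite (@aut_weight_expr k (fun i => i + 1)).
(* By [rel], [k] fixes the ratio of [y i] and [y (i + 1)], while it moves the moduli one place along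
   the cycle. *)
have kprop i : `|y i| * `|y (i + 1 + 1)| = `|y (i + 1)| ^+ 2.
  have e := rel i.
  have ke : (t i - t (i + 1 + 1)) * k (y i) = (t (i + 1 + 1) - t (i + 1)) * k (y (i + 1)).
    by have := congr1 k e; rewrite !(rmorphM k (_ - _)) !rmorphB !kt.

  have : (t i - t (i + 1 + 1)) * (y i * k (y (i + 1))) =
         (t i - t (i + 1 + 1)) * (k (y i) * y (i + 1)).
    transitivity ((t i - t (i + 1 + 1)) * y i * k (y (i + 1))); first by ring.
    rewrite e; transitivity ((t i - t (i + 1 + 1)) * k (y i) * y (i + 1)); last by ring.
    by rewrite ke; ring.
  have nz : t i - t (i + 1 + 1) != 0 by rewrite subr_eq0.
  by move/(mulfI nz)/(congr1 Num.norm); rewrite (normrM (y i)) (normrM (k _)) !knorm expr2.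
(* The cube of each modulus is the product of the three moduli. *)
have neq i : `|y i| = `|y (i + 1)|.
  have e1 := kprop (i + 1); have e2 := kprop (i + 1 + 1); rewrite !succ3 in e1 e2.
  apply/eqP; rewrite -(@eqrXn2 _ 3) ?normr_ge0 //; apply/eqP.
  by rewrite exprS -e2 [RHS]exprS -kprop; ring.
have y3' i : y i ^+ 3 = 1936%:R * \prod_i w i.
  have -> : y i ^+ 3 = \prod_i y i by rewrite (prod_cyc _ i); apply: cube_of_equal_norms.
  by rewrite /y big_split /= prod_binet_coef.
set W := \prod_i w i in y3' *.
have W0 : W != 0 by apply/prodf_neq0 => i _; apply: weight_neq0.
have WV : W^-1 \in Aint.
  have -> : W^-1 = W ^+ M.-1.
    by apply: (mulfI W0); rewrite mulfV // -exprS prednK // prod_weight_expr.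
  by rewrite rpredX // rpred_prod // => i _; apply: Aint_weight.
(* [y i] times [P'(r i)] is [44 * r i * w i]; this is cubed and divided by [y i ^+ 3 = 1936 * W].
   Summing over [i] would make 196 divisible by 44. *)
have Pcube i : (3%:R * r i ^+ 2 - 2%:R * r i - 1) ^+ 3 = 44%:R * (r i ^+ 3 * w i ^+ 3 * W^-1).
  have nz : 1936%:R * W != 0 by rewrite mulf_neq0 // pnatr_eq0.
  apply: (mulfI nz); rewrite -[in LHS](y3' i) -exprMn /y mulrAC binet_coefE //.
  by rewrite !exprMn; field.
have : (44%N %| (196%:Z)%:~R)%A.
  apply/dvdAP => //; exists (\sum_i r i ^+ 3 * w i ^+ 3 * W^-1).
    by apply: rpred_sum => i _; rewrite !rpredM ?rpredX ?Aint_weight // Aint_trib_root.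
  by rewrite mulr_sumr -(eq_bigr _ (fun i _ => Pcube i)) trib_sum_deriv3.
by rewrite dvdA_int.
Qed.

End Twisted.

(** * Roots of unity and the fundamental unit of the cubic field *)

Section Equivariant.

Variables (r : 'I_3 -> algC) (rP : trib_roots r).
Hypotheses (r0J : (r 0)^* = r 0) (r1J : (r 1)^* = r 2%:R) (r2J : (r 2%:R)^* = r 1).

(* [f i] is the image in [Q(r i)] of a fixed element of [Q(X) / (P)]. *)
Definition equivariant (f : 'I_3 -> algC) :=
  forall (nu : {rmorphism algC -> algC}) (s : {perm 'I_3}),
    (forall i, nu (r i) = r (s i)) -> forall i, nu (f i) = f (s i).

Lemma equivariant_roots : equivariant r.
Proof. by []. Qed.

Lemma equivariantM f g : equivariant f -> equivariant g ->
  equivariant (fun i => f i * g i).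
Proof. by move=> ef eg nu s rs i; rewrite rmorphM (ef nu s) ?(eg nu s). Qed.

Lemma equivariantX f (n : int) : equivariant f -> equivariant (fun i => f i ^ n).
Proof. by move=> ef nu s rs i; rewrite fmorphXz (ef nu s). Qed.

Lemma sum_equivariant_Crat f : equivariant f -> \sum_i f i \in Crat.
Proof.
move=> ef; apply: aut_fixed_Crat => nu; have [s rs] := aut_perm rP nu.
rewrite rmorph_sum [RHS](reindex_inj (@perm_inj _ s)) /=.
by apply: eq_bigr => i _; apply: ef.
Qed.

(** The 3-cycle of [aut_cycle] fixes roots of unity, so the family is constant. Its value is then
    rational with cube 1. *)
Lemma equivariant_unity f n : equivariant f -> (0 < n)%N ->
  (forall i, f i ^+ n = 1) -> \prod_i f i = 1 -> forall i, f i = 1.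
Proof.
move=> ef n0 fn fprod.
have [k [kr k1]] := aut_cycle rP r0J r1J r2J.
have [s ks] := aut_perm rP k.
have step i : f i = f (i + 1).
  rewrite -[LHS](k1 n _ n0 (fn i)) (ef k s ks); congr f.
  by apply: (trib_roots_inj rP); rewrite -ks kr.
have fc i : f i = f 0.
  have f1 : f 1 = f 0 by rewrite (step 0); congr f; apply: val_inj.
  have f2 : f 2%:R = f 0 by rewrite -f1 (step 1); congr f; apply: val_inj.
  by move: i; apply: ord3P.
have : \sum_i f i \in Crat by apply: sum_equivariant_Crat.
rewrite (eq_bigr _ (fun i _ => fc i)) sumr_const card_ord => sQ.
have /CratP[a Da] : f 0 \in Crat.
  by rewrite -(mulfK (_ : 3%:R != 0) (f 0)) ?pnatr_eq0 // mulr_natr rpredM ?rpredV ?rpred_nat.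
move: fprod; rewrite (eq_bigr _ (fun i _ => fc i)) prodr_const card_ord Da.
rewrite -rmorphXn -[RHS](rmorph1 (ratr : {rmorphism rat -> algC})) => /fmorph_inj a3 i.
rewrite fc Da; suff -> : a = 1 by rewrite rmorph1.
have /eqP : (a - 1) * (a ^+ 2 + a + 1) = 0.
  by transitivity (a ^+ 3 - 1); [ring | rewrite a3 subrr].
rewrite mulf_eq0 subr_eq0 => /orP[/eqP //|/eqP e].
by exfalso; have := sqr_ge0 (2%:R * a + 1); lra.
Qed.

(** This is the sense in which [r i] is a fundamental unit. The elementary symmetric functions of
    [f] are integers, and [unit_not_power] applies to the real conjugate [f 0]. *)
Lemma equivariant_root f m : equivariant f -> (0 < m)%N ->
  (forall i, f i ^+ m = r i) -> \prod_i f i = 1 -> m = 1.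
Proof.
move=> ef m0 fm fprod; apply/eqP; rewrite eqn_leq m0 andbT.
have fA i : f i \in Aint by apply: (Aint_expr m0); rewrite fm Aint_trib_root.
have [s cs] := aut_perm rP Num.conj.
have sE : [/\ s 0 = 0, s 1 = 2%:R & s 2%:R = 1].
  by split; apply: (trib_roots_inj rP); rewrite -cs.
have [s0 s1 s2] := sE.
have fJ i : (f i)^* = f (s i) by exact: (ef _ _ cs i).
have f0J : (f 0)^* = f 0 by rewrite fJ s0.
have f1J : (f 1)^* = f 2%:R by rewrite fJ s1.
have f2J : (f 2%:R)^* = f 1 by rewrite fJ s2.
have [fn0 fn1 fn2] : [/\ f 0 != 0, f 1 != 0 & f 2%:R != 0].
  move/eqP: fprod; rewrite prod3 => /eqP e; move: (oner_neq0 algC).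
  by rewrite -e !mulf_eq0 !negb_or => /andP[/andP[]].
have efV : equivariant (fun i => (f i)^-1).
  by move=> nu q rq i; rewrite fmorphV (ef nu q).
(* As the product is 1, the second symmetric function is the trace of the inverse, hence
   rational. *)
have fVE : \sum_i (f i)^-1 = f 0 * f 1 + f 1 * f 2%:R + f 2%:R * f 0.
  rewrite sum3 -[RHS]mulr1 -(invr1 algC) -fprod prod3; field.
  by rewrite fn0 fn1 fn2.
have /intrP[e1 De1] : \sum_i f i \in Num.int.
  by rewrite Cint_rat_Aint ?sum_equivariant_Crat // rpred_sum.
have /intrP[e2 De2] : \sum_i (f i)^-1 \in Num.int.
  by rewrite Cint_rat_Aint ?sum_equivariant_Crat // fVE !rpredD ?rpredM.
have xR : f 0 \is Creal by rewrite CrealE f0J.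
have bR : r 0 \is Creal by rewrite CrealE r0J.
have tR : f 1 + f 2%:R \is Creal by rewrite CrealE rmorphD /= f1J f2J addrC.
have p0 : 0 < f 1 * f 2%:R by rewrite -f1J -normCK exprn_gt0 ?normr_gt0.
have pR : f 1 * f 2%:R \is Creal by rewrite ger0_real // ltW.
have b0 : 0 < r 0.
  have q0 : 0 < r 1 * r 2%:R by rewrite -r1J -normCK exprn_gt0 ?normr_gt0 ?trib_root_neq0.
  by rewrite -(pmulr_lgt0 _ q0) mulrA -(prod3 r) prod_trib_roots.
have x0 : 0 < f 0 by rewrite -(pmulr_lgt0 _ p0) mulrA -(prod3 f) fprod.
have tp : (f 1 + f 2%:R) ^+ 2 <= 4%:R * (f 1 * f 2%:R).
  rewrite -subr_ge0 (_ : _ - _ = (f 1 - f 2%:R) * (f 1 - f 2%:R)^*) ?mul_conjC_ge0 //.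
  by rewrite rmorphB /= f1J f2J; ring.
apply: (@unit_not_power algR (in_algR bR) (in_algR xR) (in_algR tR) (in_algR pR) m e1 e2) => //.
- by apply: val_inj; apply: (trib_rootE rP).
- by apply: val_inj; rewrite [LHS](rmorphXn algRval) /= fm.
- by apply: val_inj; rewrite /= mulrA -(prod3 f).
- by apply: val_inj; rewrite /= [RHS](rmorph_int algRval) -De1 sum3 addrA.
- by apply: val_inj; rewrite /= [RHS](rmorph_int algRval) -De2 fVE; ring.
Qed.

End Equivariant.

(** * From a twisted zero to an exponential equation *)

Section Weights.

Variables (r : 'I_3 -> algC) (rP : trib_roots r).
Hypotheses (r0J : (r 0)^* = r 0) (r1J : (r 1)^* = r 2%:R) (r2J : (r 2%:R)^* = r 1).
Variables (w : 'I_3 -> algC) (M : nat) (B : int) (M0 : (0 < M)%N).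
Hypotheses (wM : forall i, w i ^+ M = r i ^ B)
           (sum0 : \sum_i binet_coef (r i) * w i = 0).

Let W := \prod_i w i.

Let w_neq0 := weight_neq0 rP M0 wM.

Let W_neq0 : W != 0.
Proof. by apply/prodf_neq0 => i _; apply: w_neq0. Qed.

(** Applying [nu] to the relation [sum0] gives the same relation twisted by roots of unity [t i],
    which coincide by [unity_relation_trivial]. *)
Lemma aut_weight (nu : {rmorphism algC -> algC}) (s : {perm 'I_3}) :
  (forall i, nu (r i) = r (s i)) -> exists t, forall i, nu (w i) = t * w (s i).
Proof.
move=> rs; pose t i := nu (w (perm_inv s i)) / w i.
have sK i : s (perm_inv s i) = i by rewrite permKV.
have tE i : nu (w i) = t (s i) * w (s i) by rewrite /t permK divfK.
have tM i : t i ^+ M = 1.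
  rewrite /t expr_div_n (@aut_weight_expr r w M B wM nu s) // sK divff //.
  by rewrite expf_neq0.
have sumt : \sum_i t i * (binet_coef (r i) * w i) = 0.
  rewrite (reindex_inj (@perm_inj _ s)) /= -[RHS](rmorph0 nu) -[in RHS]sum0 rmorph_sum.
  by apply: eq_bigr => i _; rewrite rmorphM /= aut_binet_coef rs tE; ring.
exists (t 0) => i; rewrite tE; congr (_ * _).
exact: (unity_relation_trivial rP r0J r1J r2J M0 wM sum0 M0 tM sumt).
Qed.

(** Homogeneous of degree 0 in [w], so that the common factor [t] of [aut_weight] cancels. *)
Let eta i := w i ^+ 3 / W.

Let eta_equivariant : equivariant r eta.
Proof.
move=> nu s rs; have [t nut] := aut_weight rs => i.
have nuW : nu W = t ^+ 3 * W.
  rewrite rmorph_prod (eq_bigr _ (fun i _ => nut i)) big_split /= prodr_const card_ord.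
  by congr (_ * _); rewrite /W [RHS](reindex_inj (@perm_inj _ s)).
have t0 : t != 0.
  apply: contraTneq W_neq0 => t0; move: nuW; rewrite t0 expr0n mul0r => /eqP.
  by rewrite fmorph_eq0 => ->.
rewrite /eta rmorphM rmorphXn fmorphV /= nut nuW exprMn.
by rewrite invfM mulrACA divff ?mul1r // expf_neq0.
Qed.

Let etaM i : eta i ^+ M = r i ^ (3 * B).
Proof.
rewrite /eta expr_div_n (prod_weight_expr rP wM) divr1 exprAC wM.
by rewrite mulrC exprnP exprz_exp.
Qed.

Let prod_eta : \prod_i eta i = 1.
Proof.
rewrite /eta big_split /= prodr_const card_ord prodrXl -/W.
by rewrite exprVn divff // expf_neq0.
Qed.

(** With [M] and [3 * B] reduced to coprime [M'] and [B'], the quotient [xi] of [eta i ^ M'] by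
    [r i ^ B'] is a root of unity of norm 1, hence 1. Then [M' = 1] because [r i] is fundamental, so
    [eta i] is an integral power of [r i]. *)
Lemma twisted_zero_cubic : exists2 b : int, 3 * B = b * M &
  \sum_i binet_coef (r i) ^+ 3 * r i ^ b = 3%:R * 1936%:R.
Proof.
have r_neq0 i : r i != 0 := trib_root_neq0 rP i.
have eta_neq0 i : eta i != 0 by rewrite mulf_neq0 ?invr_eq0 ?expf_neq0.
pose g := gcdn M `|3 * B|.
have g0 : (0 < g)%N by rewrite gcdn_gt0 M0.
have [M' DM] : exists M', M = (M' * g)%N by apply/dvdnP; apply: dvdn_gcdl.
have [B' DB] : exists B', 3 * B = B' * g%:Z.
  by apply/dvdzP; apply: dvdn_gcdr.
have M'0 : (0 < M')%N by move: M0; rewrite DM muln_gt0 => /andP[].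
have [u [v uv]] : exists u v : int, u * M' + v * B' = 1.
  have [u [v E]] := Bezoutz M (3 * B); exists u, v.
  have gz : g%:Z != 0 by move: g0; rewrite lt0n.
  apply: (mulIf gz); rewrite mul1r mulrDl -!mulrA -DB -PoszM -DM E.
  by rewrite /gcdz /=.
pose xi i := eta i ^ M' * r i ^ (- B').
have exi : equivariant r xi.
  by apply: equivariantM; apply: equivariantX => //; apply: equivariant_roots.
have xig i : xi i ^+ g = 1.
  rewrite exprnP expfzMl !exprz_exp -PoszM -DM -exprnP etaM -expfzDr //.
  by rewrite DB mulNr subrr expr0z.
have prod_r (b : int) : \prod_i r i ^ b = 1.
  by rewrite prod3 -!expfzMl -(prod3 r) prod_trib_roots // exp1rz.
have prod_etaX (b : int) : \prod_i eta i ^ b = 1.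
  by rewrite prod3 -!expfzMl -(prod3 eta) prod_eta exp1rz.
have xi1 i : xi i = 1.
  apply: (equivariant_unity rP r0J r1J r2J exi g0 xig).
  by rewrite big_split /= prod_r prod_etaX mulr1.
have etaM' i : eta i ^ M' = r i ^ B'.
  by apply/eqP; rewrite -subr_eq0 -(mulIr_eq0 _ (mulIf (expfz_neq0 (- B') (r_neq0 i))))
    mulrBl -/(xi i) xi1 -expfzDr // subrr expr0z subrr.
(* By the Bezout relation [r i ^ u * eta i ^ v] is an [M']-th root of [r i]. *)
have M1 : M' = 1%N.
  apply: (@equivariant_root r rP r0J r1J r2J (fun i => r i ^ u * eta i ^ v)) => //.
  - by apply: equivariantM; apply: equivariantX => //; apply: equivariant_roots.
  - move=> i; rewrite exprnP expfzMl exprz_exp exprzAC etaM' exprz_exp -expfzDr //.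
    by rewrite [B' * v]mulrC uv.
  - by rewrite big_split /= prod_r prod_etaX mulr1.
exists B'; first by rewrite DB DM M1 mul1n.
have etaE i : r i ^ B' = eta i by rewrite -etaM' M1.
(* Three numbers of sum 0 have as sum of cubes three times their product. *)
have : \sum_i (binet_coef (r i) * w i) ^+ 3 = 3%:R * (1936%:R * W).
  rewrite -(prod_binet_coef rP) -big_split /= prod3 sum3.
  move: sum0; rewrite sum3; move: (_ * w 0) (_ * w 1) (_ * w 2%:R) => y0 y1 y2 y012.
  have -> : y2 = - (y0 + y1) by apply/eqP; rewrite -addr_eq0 addrC y012.
  by ring.
move=> E; apply: (mulIf W_neq0); rewrite mulr_suml.
transitivity (\sum_i (binet_coef (r i) * w i) ^+ 3); last by rewrite E; ring.
by apply: eq_bigr => i _; rewrite etaE /eta exprMn -mulrA divfK.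
Qed.

End Weights.

(** * Skolem's method *)

Section Skolem.

Variables (r : 'I_3 -> algC) (rP : trib_roots r).
Variables (a : 'I_3 -> algC) (aA : forall i, a i \in Aint).
Variables (q N : nat) (qp : prime q) (q2 : q != 2%N).
Hypothesis rN : forall i, (q %| r i ^+ N - 1)%A.

Let L (s : int) := \sum_i a i * r i ^ s.

Lemma trib_seq_period (s : int) (t : nat) : (q %| L (s + (N * t)%N) - L s)%A.
Proof.
rewrite /L -sumrB; apply: rpred_sum => i _.
have r0 : r i \is a GRing.unit by rewrite unitfE trib_root_neq0.
rewrite exprzDr // -exprnP exprM.
have -> : a i * (r i ^ s * r i ^+ N ^+ t) - a i * r i ^ s =
  (r i ^+ N - 1) * ((\sum_(k < t) (r i ^+ N) ^+ (t.-1 - k) * 1 ^+ k) * (a i * r i ^ s)).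
  by rewrite mulrA -subrXX expr1n; ring.
have rA := Aint_trib_root rP i.
rewrite dvdA_mulr // !rpredM ?Aint_trib_rootX // rpred_sum // => k _.
by rewrite rpredM ?rpredX ?rpred1.
Qed.

(* Since [q ^ 2] does not divide [d], the valuation of [L (s + N * m) - L s] is
   exactly one more than that of [m]. *)
Lemma trib_seq_unique (s s' : int) (d : int) : L s = L s' ->
  ((q ^ 2)%N %| (L (s + N) - L s) - d%:~R)%A -> ~~ ((q ^ 2)%N%:Z %| d)%Z ->
  forall m : nat, s' = s + (N * m)%N -> s' = s.
Proof.
move=> Lss Ld dq m Ds'; case: (posnP m) => [m0|m_gt0].
  by rewrite Ds' m0 muln0 addr0.
case/negP: dq; have q0 := prime_gt0 qp.
have [m' qm' Dm] : exists2 m', ~~ (q %| m')%N & m = (q ^ logn q m * m')%N.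
  have [m' cop Dm] := pfactor_coprime qp m_gt0.
  by exists m'; [rewrite -prime_coprime | rewrite mulnC].
set j := logn q m in Dm.
have := trib_seq_lift rP aA qp q2 rN s j m'; rewrite -/(L _) -Dm -Ds' -/(L _) -/(L _) -Lss subrr sub0r.
rewrite rpredN => /(dvdAP _ (_ : 0 < q ^ j.+2)%N)[]; first by rewrite expn_gt0 q0.
move=> y yA; rewrite Dm natrM -mulrA => E.
have qj : (q ^ j)%:R != 0 :> algC by rewrite pnatr_eq0 -lt0n expn_gt0 q0.
have {}E : m'%:R * (L (s + N) - L s) = (q ^ 2)%:R * y.
  apply: (mulfI qj); rewrite E mulrA -natrM -expnD addn2 //.
have q20 : (0 < q ^ 2)%N by rewrite expn_gt0 q0.
have : ((q ^ 2)%N %| (m'%:Z * d)%:~R)%A.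
  have -> : (m'%:Z * d)%:~R = m'%:R * (L (s + N) - L s)
      - ((L (s + N) - L s) - d%:~R) * m'%:R.
    by rewrite intrM; ring.
  apply: rpredB; last by rewrite dvdA_mulr ?rpred_nat.
  by rewrite E; apply/dvdAP => //; exists y.
rewrite dvdA_int // Gauss_dvdzr //.
by rewrite coprimezE /= coprimeXl // prime_coprime.
Qed.

End Skolem.

(* Computations for Skolem's method *)
Delimit Scope Z_scope with BZ.

(** Binary integers keep these runs fast under [vm_compute]. *)
Definition skolem_next (u : Z * Z * Z) := let: (x, y, z) := u in (y, z, (x + y + z)%BZ).
Definition skolem_prev (u : Z * Z * Z) := let: (x, y, z) := u in ((z - y - x)%BZ, x, y).
(* The sequence is [\sum_i binet_coef (r i) ^+ 3 * r i ^ n / 1936], running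
   forwards or backwards from [n = 0]. *)
Definition skolem_fwd n := iter n skolem_next (3, 3, 5)%BZ.
Definition skolem_bwd n := iter n skolem_prev (3, 3, 5)%BZ.
(* Coordinates of [r i ^+ n] in the basis [1, r i, r i ^+ 2] *)
Definition root_power n : Z * Z * Z :=
  iter n (fun u => let: (x, y, z) := u in (z, (x + z)%BZ, (y + z)%BZ)) (1, 0, 0)%BZ.

Definition skolem_period (q N : nat) :=
  let: (x, y, z) := root_power N in
  [&& (x - 1) mod Z.of_nat q =? 0, y mod Z.of_nat q =? 0 & z mod Z.of_nat q =? 0]%BZ.

(** A class where the value 3 is possible modulo [q] must be listed, and its slope must be nonzero
    modulo [q ^ 2], as [trib_seq_unique] requires for uniqueness. *)
Definition skolem_sieve (q N : nat) (cl : seq nat) :=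
  all (fun n =>
    (((skolem_fwd n).1.1 - 3) mod Z.of_nat q =? 0)%BZ ==> (n \in cl) &&
    ~~ (((skolem_fwd (n + N)).1.1 - (skolem_fwd n).1.1)
          mod (Z.of_nat q * Z.of_nat q) =? 0)%BZ)
  (iota 0 N).

Lemma skolem_period397 : skolem_period 397 132.
Proof. by vm_compute. Qed.

(** The listed classes are those of the solutions 0, 1, -51, -12, -5, -3 modulo 132. *)
Lemma skolem_sieve397 : skolem_sieve 397 132 [:: 0; 1; 81; 120; 127; 129].
Proof. by vm_compute. Qed.

Lemma skolem_bwd_zeros : all (fun n => (skolem_bwd n).1.1 == 3%BZ) [:: 0; 3; 5; 12; 51].
Proof. by vm_compute. Qed.

Definition ZtoC (z : Z) : algC := (int_of_Z z)%:~R.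

Lemma ZtoCD x y : ZtoC (x + y)%BZ = ZtoC x + ZtoC y.
Proof. by rewrite /ZtoC -rmorphD -(rmorphD int_of_Z). Qed.

Lemma ZtoCB x y : ZtoC (x - y)%BZ = ZtoC x - ZtoC y.
Proof. by rewrite /ZtoC -rmorphB -(rmorphB int_of_Z). Qed.

Lemma ZtoC_dvd (q : nat) z : (0 < q)%N -> (q %| ZtoC z)%A = (z mod Z.of_nat q =? 0)%BZ.
Proof.
move=> q0; rewrite /ZtoC dvdA_int //.
apply/dvdzP/idP => [[k Dk]|/Z.eqb_eq h].
  have -> : z = (Z_of_int k * Z.of_nat q)%BZ.
    by apply: (can_inj int_of_ZK); rewrite Dk; lia.
  by apply/Z.eqb_eq; rewrite Z.mod_mul //; lia.
have [k Dk] : Z.divide (Z.of_nat q) z by apply/Z.mod_divide => //; lia.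
by exists (int_of_Z k); rewrite Dk; lia.
Qed.

Section SkolemTrib.

Variables (r : 'I_3 -> algC) (rP : trib_roots r).

Let L (s : int) := \sum_i binet_coef (r i) ^+ 3 * r i ^ s.

Let L_rec (s : int) : L (s + 3%:Z) = L (s + 2%:Z) + L (s + 1%:Z) + L s.
Proof.
rewrite /L -!big_split /=; apply: eq_bigr => i _.
have r0 : r i \is a GRing.unit by rewrite unitfE trib_root_neq0.
rewrite !exprzDr // -!exprnP (trib_rootE rP); ring.
Qed.

Let L_base : [/\ L 0%:Z = 1936%:R * ZtoC 3%BZ, L 1%:Z = 1936%:R * ZtoC 3%BZ & L 2%:Z = 1936%:R * ZtoC 5%BZ].
Proof.
rewrite /L; split.
(* These quadratics are [binet_coef (r i) ^+ 3 * r i ^ s] reduced modulo [P]. *)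
- rewrite (eq_bigr (fun i => 880%:R * r i ^+ 2 + (- 528%:R) * r i + 1232%:R)) => [|i _].
    by rewrite trib_sum_quad //; ring.
  by rewrite /binet_coef expr0z; have h := trib_rootE rP i; ring: h.
- rewrite (eq_bigr (fun i => 352%:R * r i ^+ 2 + 2112%:R * r i + 880%:R)) => [|i _].
    by rewrite trib_sum_quad //; ring.
  by rewrite /binet_coef expr1z; have h := trib_rootE rP i; ring: h.
- rewrite (eq_bigr (fun i => 2464%:R * r i ^+ 2 + 1232%:R * r i + 352%:R)) => [|i _].
    by rewrite trib_sum_quad //; ring.
  by rewrite /binet_coef -exprnP; have h := trib_rootE rP i; ring: h.
Qed.

Let L_fwd n : let: (x, y, z) := skolem_fwd n in
  [/\ L n%:Z = 1936%:R * ZtoC x, L n.+1%:Z = 1936%:R * ZtoC y & L n.+2%:Z = 1936%:R * ZtoC z].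
Proof.
elim: n => [|n]; first exact: L_base.
rewrite /skolem_fwd iterS -/(skolem_fwd n); case: (skolem_fwd n) => [[x y] z] /= [hx hy hz].
split=> //; have := L_rec n; rewrite -!PoszD !addnS addn0 => ->.
by rewrite hx hy hz !ZtoCD; ring.
Qed.

Let L_bwd n : let: (x, y, z) := skolem_bwd n in
  [/\ L (- n%:Z) = 1936%:R * ZtoC x, L (1 - n%:Z) = 1936%:R * ZtoC y
    & L (2%:Z - n%:Z) = 1936%:R * ZtoC z].
Proof.
elim: n => [|n]; first by rewrite oppr0 !subr0; exact: L_base.
rewrite /skolem_bwd iterS -/(skolem_bwd n); case: (skolem_bwd n) => [[x y] z] /= [hx hy hz].
have e1 : 1 - n.+1%:Z = - n%:Z by lia.
have e2 : 2%:Z - n.+1%:Z = 1 - n%:Z by lia.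
rewrite e1 e2; split=> //.
have := L_rec (- n.+1%:Z); rewrite !(addrC (- n.+1%:Z)) e1 e2.
have -> : 3%:Z - n.+1%:Z = 2%:Z - n%:Z by lia.
by rewrite hx hy hz !ZtoCB => e; rewrite !mulrBr e; ring.
Qed.

Lemma root_power_coords i n : let: (x, y, z) := root_power n in
  r i ^+ n = ZtoC x + ZtoC y * r i + ZtoC z * r i ^+ 2.
Proof.
elim: n => [|n]; first by rewrite /= /ZtoC /= !mul0r !addr0.
rewrite /root_power iterS -/(root_power n); case: (root_power n) => [[x y] z] /= IH.
rewrite exprS IH !ZtoCD !mulrDr (_ : r i * (ZtoC z * _) = ZtoC z * r i ^+ 3); last by ring.
by rewrite (trib_rootE rP); ring.
Qed.

Lemma skolem_periodP q N i : (0 < q)%N -> skolem_period q N -> (q %| r i ^+ N - 1)%A.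
Proof.
move=> q0; have := root_power_coords i N; rewrite /skolem_period.
case: (root_power N) => [[x y] z] -> /and3P[xq yq zq].
have rA := Aint_trib_root rP i.
have -> : ZtoC x + ZtoC y * r i + ZtoC z * r i ^+ 2 - 1
  = ZtoC (x - 1)%BZ + ZtoC y * r i + ZtoC z * r i ^+ 2 by rewrite ZtoCB -[ZtoC 1]/(1 : algC); ring.
apply: rpredD; first apply: rpredD; rewrite ?dvdA_mulr ?rpredX //; by rewrite ZtoC_dvd.
Qed.

(** Since [L] has period [N] modulo [q], the sieve lists the class of [b]. The slopes at [b] and
    [b'] agree with that at [n] modulo [q ^ 2], so [trib_seq_unique] identifies [b] and [b'];
    coprimality to 1936 relates [L] to the computed sequence. *)
Lemma skolem_unique q N cl (b : int) : prime q -> coprime q 1936 -> (0 < N)%N ->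
  skolem_period q N -> skolem_sieve q N cl -> L b = 3%:R * 1936%:R ->
  exists n : nat, [/\ n \in cl, (N%:Z %| b - n%:Z)%Z
    & forall b', L b' = 3%:R * 1936%:R -> (N%:Z %| b - b')%Z -> b' = b].
Proof.
move=> qp q1936 N0 perq sieve Lb.
have q0 := prime_gt0 qp.
have q2 : q != 2%N by apply: contraTneq q1936 => ->.
have aA i : binet_coef (r i) ^+ 3 \in Aint by rewrite rpredX // Aint_binet_coef.
have rN i := skolem_periodP i q0 perq.
have N_neq0 : N%:Z != 0 by move: N0; rewrite lt0n.
have shiftP (x y : int) : (N%:Z %| x - y)%Z ->
    exists t : nat, x = y + (N * t)%N \/ y = x + (N * t)%N.
  case/dvdzP => k Dk; exists `|k|%N; case: k Dk => k Dk; [left | right]; lia.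
pose n := `|(b %% N%:Z)%Z|%N.
have nE : n%:Z = (b %% N%:Z)%Z by rewrite /n gez0_abs // modz_ge0.
have nN : (n < N)%N by rewrite -ltz_nat nE ltz_pmod.
have bn : (N%:Z %| b - n%:Z)%Z.
  by apply/dvdzP; exists (b %/ N%:Z)%Z; rewrite nE {1}(divz_eq b N) addrK.
have [t Dt] := shiftP _ _ bn.
have Ln k : L k%:Z = 1936%:R * ZtoC (skolem_fwd k).1.1.
  by have := L_fwd k; case: (skolem_fwd k) => [[x y] z] [].
have Lbn : (q %| L b - L n%:Z)%A.
  have per := trib_seq_period rP aA rN.
  by case: Dt => ->; [exact: per | rewrite -opprB rpredN; exact: per].
have nq : (((skolem_fwd n).1.1 - 3) mod Z.of_nat q =? 0)%BZ.
  rewrite -ZtoC_dvd //; have : (q %| (1936%:Z * (int_of_Z ((skolem_fwd n).1.1 - 3)%BZ))%:~R)%A.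
    move: Lbn; rewrite Lb Ln -rpredN; congr (_ %| _)%A.
    rewrite intrM -/(ZtoC _) ZtoCB -[ZtoC 3]/(3%:R : algC); ring.
  by rewrite dvdA_int // Gauss_dvdzr ?coprimezE // -dvdA_int.
have nI : n \in iota 0 N by rewrite mem_iota.
have := allP sieve n nI; rewrite nq /= => /andP[ncl].
rewrite -[(_ * _)%BZ](Nat2Z.inj_mul) -ZtoC_dvd ?muln_gt0 ?q0 //.
set e := (_ - _)%BZ => eq2.
exists n; split=> // b' Lb' bb'.
have d_ndvd : ~~ ((q ^ 2)%N%:Z %| 1936%:Z * int_of_Z e)%Z.
  rewrite Gauss_dvdzr; last by rewrite coprimezE /= coprimeXl.
  by rewrite -dvdA_int ?expn_gt0 ?q0 // -mulnn.
have step (s s' : int) u : s' = s + (N * u)%N ->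
    ((q ^ 2)%N %| (L (s' + N) - L s') - (L (s + N) - L s))%A.
  by move=> ->; apply: trib_seq_step.
have dE : (1936%:Z * int_of_Z e)%:~R = L (n%:Z + N) - L n%:Z.
  by rewrite -PoszD !Ln intrM -/(ZtoC _) ZtoCB mulrBr.
have Db : ((q ^ 2)%N %| (L (b + N) - L b) - (1936%:Z * int_of_Z e)%:~R)%A.
  by rewrite dE; case: Dt => h; [ | rewrite -opprB rpredN]; apply: step h.
have Db' : ((q ^ 2)%N %| (L (b' + N) - L b') - (1936%:Z * int_of_Z e)%:~R)%A.
  rewrite (_ : _ - _ = (L (b' + N) - L b' - (L (b + N) - L b))
     + ((L (b + N) - L b) - (1936%:Z * int_of_Z e)%:~R)); last by ring.
  rewrite rpredD //; case: (shiftP _ _ bb') => u [] h; last exact: step h.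
  by rewrite -opprB rpredN; apply: step h.
have uniq := trib_seq_unique rP aA qp q2 rN.
case: (shiftP _ _ bb') => u [] h.
  exact/esym/(uniq b' b _ (etrans Lb' (esym Lb)) Db' d_ndvd u h).
exact: (uniq b b' _ (etrans Lb (esym Lb')) Db d_ndvd u h).
Qed.

Lemma skolem_zeros (b : int) : L b = 3%:R * 1936%:R ->
  b \in [:: 0; 1; - 3%:Z; - 5%:Z; - 12%:Z; - 51%:Z].
Proof.
move=> Lb; have Z3 : ZtoC 3%BZ = 3%:R by [].
have zero n : n \in [:: 0; 3; 5; 12; 51]%N -> L (- n%:Z) = 3%:R * 1936%:R.
  move=> nI; have := L_bwd n; have /eqP := allP skolem_bwd_zeros n nI.
  case: (skolem_bwd n) => [[x y] z] /= -> [-> _ _]; by rewrite Z3; ring.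
have one : L 1%:Z = 3%:R * 1936%:R.
  by have [_ -> _] := L_base; rewrite Z3; ring.
have q_prime : prime 397 by [].
have q1936 : coprime 397 1936 by [].
have [n [ncl /dvdzP[k Dk] uniq]] :=
  skolem_unique q_prime q1936 (isT : (0 < 132)%N) skolem_period397 skolem_sieve397 Lb.
(* Below [j] is 1 for the negative solutions, whose class is listed by its residue between 0 and
   131. *)
have uniq' b' (j : int) : L b' = 3%:R * 1936%:R -> n%:Z - b' = j * 132%:Z -> b = b'.
  move=> Lb' Dj; apply/esym/(uniq b' Lb')/dvdzP; exists (k + j).
  by rewrite mulrDl -Dj -[k * _]Dk; ring.
move: ncl uniq'; rewrite !inE => /or4P[|||/or3P[]] /eqP ->
  uniq'; clear uniq Dk Lb.
- by rewrite (uniq' (- 0%:Z) 0) ?zero.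
- by rewrite (uniq' 1%:Z 0).
- by rewrite (uniq' (- 51%:Z) 1) ?zero.
- by rewrite (uniq' (- 12%:Z) 1) ?zero.
- by rewrite (uniq' (- 5%:Z) 1) ?zero.
- by rewrite (uniq' (- 3%:Z) 1) ?zero.
Qed.

End SkolemTrib.

(** * The period modulo p *)

(** Multiplication by [x] permutes [S]; compare the products of all elements before and after. *)
Lemma expf_card_stable (F : finFieldType) (S : {set F}) (x : F) :
  0 \notin S -> x != 0 -> (forall s, s \in S -> x * s \in S) -> x ^+ #|S| = 1.
Proof.
move=> S0 x0 xS.
have inj : injective ( *%R x) := mulfI x0.
have E : [set x * s | s in S] = S.
  apply/eqP; rewrite eqEcard card_imset // leqnn andbT.
  by apply/subsetP => _ /imsetP[s sS ->]; apply: xS.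
have : \prod_(s in S) s = x ^+ #|S| * \prod_(s in S) s.
  rewrite -[in LHS]E big_imset /=; last by move=> ? ? _ _; apply: inj.
  by rewrite big_split /= prodr_const.
rewrite -{1}[\prod_(s in S) s]mul1r => /mulIf -> //.
by apply/prodf_neq0 => s sS; apply: contraNneq S0 => <-.
Qed.

(** The set counted by [gen_order] is stable under each generator, as exponents may be reduced
    modulo [#|F|.-1], so [expf_card_stable] applies. *)
Lemma gen_orderP (F : finFieldType) (r1 r2 r3 : F) : r1 != 0 -> r2 != 0 -> r3 != 0 ->
  [/\ r1 ^+ gen_order r1 r2 r3 = 1, r2 ^+ gen_order r1 r2 r3 = 1,
      r3 ^+ gen_order r1 r2 r3 = 1 & (0 < gen_order r1 r2 r3)%N].
Proof.
move=> r10 r20 r30; rewrite /gen_order.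
set S := [set _ | _ in _].
have card_gt1 : (1 < #|F|)%N := finNzRing_gt1 F.
have modF (x : F) a : x != 0 -> x ^+ (a %% #|F|.-1) = x ^+ a.
  move=> x0; apply: expr_mod; apply: (mulfI x0).
  by rewrite -exprS prednK ?expf_card ?mulr1 // ltnW.
have ltF a : (a %% #|F|.-1 < #|F|)%N.
  by apply: leq_trans (leq_pred _); rewrite ltn_mod -ltnS prednK // ltnW.
have memS a b c : r1 ^+ a * r2 ^+ b * r3 ^+ c \in S.
  apply/imsetP; exists (Ordinal (ltF a), Ordinal (ltF b), Ordinal (ltF c)) => //=.
  by rewrite !modF.
have S0 : 0 \notin S.
  apply/imsetP => -[[[a b] c] _] /eqP; apply/negP.
  by rewrite eq_sym !mulf_neq0 ?expf_neq0.
have SP s : s \in S -> exists a b c, s = r1 ^+ a * r2 ^+ b * r3 ^+ c.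
  by case/imsetP => -[[a b] c] _ ->; exists a, b, c.
split; last by rewrite card_gt0; apply/set0Pn; exists 1; have := memS 0 0 0; rewrite !expr0 !mul1r.
- apply: expf_card_stable => // s /SP[a [b [c ->]]].
  by rewrite !mulrA -exprS.
- apply: expf_card_stable => // s /SP[a [b [c ->]]].
  by rewrite (_ : _ * _ = r1 ^+ a * r2 ^+ b.+1 * r3 ^+ c) // exprS; ring.
- apply: expf_card_stable => // s /SP[a [b [c ->]]].
  by rewrite (_ : _ * _ = r1 ^+ a * r2 ^+ b * r3 ^+ c.+1) // exprS; ring.
Qed.

Lemma tribpoly_roots_neq (F : fieldType) (p : nat) (a b c : F) :
  p \in [pchar F] -> p != 2%N -> p != 11%N ->
  tribpoly F = ('X - a%:P) * ('X - b%:P) * ('X - c%:P) ->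
  [/\ a != b, b != c, c != a & [/\ a != 0, b != 0 & c != 0]].
Proof.
move=> Fp p2 p11 split3.
have d0 : ((a - b) * (b - c) * (c - a)) ^+ 2 != 0.
  rewrite (tribpoly_disc split3) oppr_eq0 -(dvdn_pcharf Fp) (_ : 44 = 2 ^ 2 * 11)%N //.
  have pp := pcharf_prime Fp.
  by rewrite Euclid_dvdM // Euclid_dvdX // !dvdn_prime2 // (negPf p2) (negPf p11).
move: d0; rewrite sqrf_eq0 !mulf_eq0 !negb_or !subr_eq0 => /andP[/andP[-> ->] ->].
have [_ _ /eqP e3] := tribpoly_vieta split3; split=> //.
by move: (oner_neq0 F); rewrite -(eqP e3) !mulf_eq0 !negb_or => /andP[/andP[-> ->] ->].
Qed.

(** Divide ['X^N - 1] by [P] over the integers. The remainder has degree below 3 and three distinct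
    roots in [F], so [p] divides its coefficients; evaluate at [r i]. *)
Lemma trib_root_period (F : finFieldType) (p N : nat) (a b c : F) (r : 'I_3 -> algC) i :
  trib_roots r -> p \in [pchar F] -> p != 2%N -> p != 11%N ->
  tribpoly F = ('X - a%:P) * ('X - b%:P) * ('X - c%:P) ->
  a ^+ N = 1 -> b ^+ N = 1 -> c ^+ N = 1 -> (p %| r i ^+ N - 1)%A.
Proof.
move=> rP Fp p2 p11 split3 aN bN cN.
have [ab bc ca _] := tribpoly_roots_neq Fp p2 p11 split3.
pose u := Pdiv.Ring.rdivp ('X^N - 1) (tribpoly int); pose v := Pdiv.Ring.rmodp ('X^N - 1) (tribpoly int).
have Duv : 'X^N - 1 = u * tribpoly int + v.
  by apply: Pdiv.RingMonic.rdivp_eq; apply: monic_tribpoly.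
have szv : (size v < 4)%N.
  by rewrite -(size_tribpoly int) Pdiv.Ring.ltn_rmodpN0 ?monic_neq0 ?monic_tribpoly.
have rootv x : x ^+ N = 1 -> root (tribpoly F) x -> root (map_poly intr v) x.
  move=> xN xT; rewrite /root.
  have -> : map_poly intr v = 'X^N - 1 - map_poly intr u * tribpoly F :> {poly F}.
    rewrite -(map_tribpoly (intr : int -> F)) -rmorphM /=.
    rewrite (_ : 'X^N - 1 = map_poly intr ('X^N - 1)); last first.
      by rewrite rmorphB /= map_polyXn rmorph1.
    by rewrite -rmorphB /= Duv addrAC subrr add0r.
  by rewrite !hornerD !hornerN hornerM (rootP xT) mulr0 hornerXn hornerC xN subrr subr0.
have v0 : map_poly intr v = 0 :> {poly F}.
  apply: (@roots_geq_poly_eq0 _ _ [:: a; b; c]).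
  - by rewrite /= !rootv // split3 !rootM !root_XsubC eqxx ?orbT.
  - by rewrite /= !inE negb_or ab bc eq_sym ca.
  - by apply: leq_trans (size_poly _ _) _; rewrite -ltnS.
have pv k : (p%:Z %| v`_k)%Z.
  have : (v`_k)%:~R = 0 :> F by rewrite -(coef_map (intr : int -> F)) v0 coef0.
  case: (v`_k) => n; rewrite ?NegzE ?rmorphN /= => /eqP.
    by rewrite -pmulrn -(dvdn_pcharf Fp).
  by rewrite oppr_eq0 -pmulrn -(dvdn_pcharf Fp).
have p0 := prime_gt0 (pcharf_prime Fp).
have rA := Aint_trib_root rP i.
have -> : r i ^+ N - 1 = (map_poly intr v).[r i].
  have rT : (tribpoly algC).[r i] = 0 by apply/rootP/(root_tribP rP); exists i.
  have -> : map_poly intr v = 'X^N - 1 - map_poly intr u * tribpoly algC.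
    have E : map_poly intr ('X^N - 1 - u * tribpoly int) = map_poly intr v :> {poly algC}.
      by rewrite Duv addrAC subrr add0r.
    by rewrite -E !rmorphB rmorphM /= map_polyXn rmorph1 map_tribpoly.
  by rewrite !hornerD !hornerN hornerM rT mulr0 hornerXn hornerC subr0.
rewrite horner_coef rpred_sum // => k _.
by rewrite dvdA_mulr ?rpredX // coef_map /= dvdA_int.
Qed.

(** * p-adic zeros of the Tribonacci sequence *)

Lemma binet (r : 'I_3 -> algC) (n : nat) : trib_roots r ->
  \sum_i binet_coef (r i) * r i ^ n%:Z = 44%:R * (T n%:Z)%:~R.
Proof.
move=> rP; pose S k := \sum_i binet_coef (r i) * r i ^+ k.
rewrite [LHS](_ : _ = S n) //=.
have S_rec k : S k.+3 = S k.+2 + S k.+1 + S k.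
  rewrite /S -!big_split /=; apply: eq_bigr => i _.
  have -> : r i ^+ k.+3 = r i ^+ k * r i ^+ 3 by rewrite -exprD addn3.
  by rewrite (trib_rootE rP) !exprS; ring.
suff : let: (x, y, z) := Tfwd n in
    [/\ S n = 44%:R * x%:~R, S n.+1 = 44%:R * y%:~R & S n.+2 = 44%:R * z%:~R].
  by case: (Tfwd n) => [[x y] z] [].
elim: n => [|n] /=.
  rewrite /S; split.
  - rewrite (eq_bigr (fun i => 10%:R * r i ^+ 2 + (- 6%:R) * r i + (- 8%:R))) => [|i _].
      by rewrite trib_sum_quad //; ring.
    by rewrite /binet_coef; ring.
  - rewrite (eq_bigr (fun i => 4%:R * r i ^+ 2 + 2%:R * r i + 10%:R)) => [|i _].
      by rewrite trib_sum_quad //; ring.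
    by rewrite /binet_coef; have h := trib_rootE rP i; ring: h.
  - rewrite (eq_bigr (fun i => 6%:R * r i ^+ 2 + 14%:R * r i + 4%:R)) => [|i _].
      by rewrite trib_sum_quad //; ring.
    by rewrite /binet_coef; have h := trib_rootE rP i; ring: h.
case: (Tfwd n) => [[x y] z] [hx hy hz]; split=> //.
by rewrite S_rec hx hy hz !rmorphD /=; ring.
Qed.

Section Padic.

Variables (r : 'I_3 -> algC) (rP : trib_roots r).
Variables (p N : nat) (pp : prime p) (p2 : p != 2%N) (p11 : p != 11%N).
Hypothesis rN : forall i, (p %| r i ^+ N - 1)%A.

Let aA i : binet_coef (r i) \in Aint := Aint_binet_coef rP i.

Let p44 k : coprimez (p ^ k)%N%:Z 44%:Z.
Proof.
rewrite coprimezE /= coprimeXl // prime_coprime // (_ : 44 = 2 ^ 2 * 11)%N //.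
by rewrite Euclid_dvdM // Euclid_dvdX // !dvdn_prime2 // (negPf p2) (negPf p11).
Qed.

Let pk0 k : (0 < p ^ k)%N.
Proof. by rewrite expn_gt0 prime_gt0. Qed.

Let cancel44 k (x : int) (y : algC) : ((p ^ k)%N %| y)%A -> y = 44%:R * x%:~R ->
  ((p ^ k)%N%:Z %| x)%Z.
Proof.
move=> py Dy; rewrite -(Gauss_dvdzr _ (p44 k)) -dvdA_int //.
by rewrite intrM -[44%:~R]/(44%:R : algC) -Dy.
Qed.

Let Tr (n : nat) : \sum_i binet_coef (r i) * r i ^ n%:Z = 44%:R * (T n%:Z)%:~R := binet n rP.

Lemma T_lift (s j m : nat) :
  ((p ^ j.+2)%N%:Z %| T (s + N * (p ^ j * m))%N - T s - (p ^ j * m)%N%:Z * (T (s + N)%N - T s))%Z.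
Proof.
apply: (cancel44 (trib_seq_lift rP aA pp p2 rN s j m)).
by rewrite -!PoszD !Tr !(rmorphB, rmorphM) /=; ring.
Qed.

Lemma T_step (s t : nat) :
  ((p ^ 2)%N%:Z %| (T (s + N * t + N)%N - T (s + N * t)%N) - (T (s + N)%N - T s))%Z.
Proof.
apply: (cancel44 (trib_seq_step rP aA pp rN s t)).
by rewrite -!PoszD !Tr !rmorphB /=; ring.
Qed.

Lemma T_period (s t : nat) : (p%:Z %| T (s + N * t)%N - T s)%Z.
Proof.
rewrite -(expn1 p); apply: (@cancel44 1 _ (44%:R * (T (s + N * t)%N - T s)%:~R)) => //.
have := trib_seq_period rP aA rN s t.
by rewrite expn1 -!PoszD !Tr rmorphB mulrBr.
Qed.

Section Lift.

Variable l : nat.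
Hypothesis (TD : ~~ ((p ^ 2)%N%:Z %| T (l + N)%N - T l)%Z).

(** The slope at [l + N * m] is [d * p] with [d] prime to [p], so moving [m] by [p ^ k * x] adds
    about [p ^ k.+1 * d * x], and [x] can be chosen to cancel the next digit. *)
Lemma T_hensel_step k m : ((p ^ k.+1)%N%:Z %| T (l + N * m)%N)%Z ->
  exists s : nat, ((p ^ k.+2)%N%:Z %| T (l + N * (m + p ^ k * s.+1))%N)%Z.
Proof.
move=> /dvdzP[t Dt].
set D := T (l + N * m + N)%N - T (l + N * m)%N.
have [d Dd] : exists d, D = d * p%:Z.
  apply/dvdzP; have := T_period (l + N * m) 1; by rewrite muln1.
have pd : ~~ (p%:Z %| d)%Z.
  apply: contra TD => /dvdzP[d' Dd']; apply/dvdzP.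
  have /dvdzP[c Dc] := T_step l m; exists (d' - c).
  rewrite mulrBl -Dc -/D Dd Dd' -mulnn PoszM; ring.
have [e [f ef]] : exists e f : int, e * d + f * p%:Z = 1.
  have /coprimezP[[e f] /= ?] : coprimez d p.
    by rewrite coprimez_sym coprimezE /= prime_coprime.
  by exists e, f.
have p0 : p%:Z != 0 by have := prime_gt0 pp; rewrite lt0n.
(* The digit is [s.+1] rather than [s], so that the index strictly increases. *)
pose s := (`|((- t * e - 1) %% p)%Z|)%N; exists s.
have Ds : exists c, t + s.+1%:Z * d = c * p%:Z.
  have Es := divz_eq (- t * e - 1) p.
  have E : s%:Z = ((- t * e - 1) %% p)%Z by rewrite /s gez0_abs // modz_ge0.
  exists (t * f - ((- t * e - 1) %/ p)%Z * d).
  have -> : s.+1%:Z = s%:Z + 1 by lia.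
  rewrite E; have -> : ((- t * e - 1) %% p)%Z = - t * e - 1 - ((- t * e - 1) %/ p)%Z * p.
    by rewrite {2}Es; ring.
  have tE : t = t * (e * d + f * p%:Z) by rewrite ef mulr1.
  by rewrite [X in X + _]tE; ring.
case: Ds => c Dc.
have /dvdzP[c' Dc'] := T_lift (l + N * m) k s.+1; apply/dvdzP; exists (c' + c).
rewrite mulnDr addnA mulrDl -Dc' -/D Dt Dd.
have -> : c * (p ^ k.+2)%N%:Z = c * p * (p%:Z * (p ^ k)%N) by rewrite !expnS !PoszM; ring.
by rewrite -Dc expnS !PoszM; ring.
Qed.

(** Iterated lifting; the growth of [m'] provides arbitrarily large indices, and [p ^ k] dividing
    [m' - m] keeps them in a fixed class. *)
Lemma T_hensel j : forall k m, ((p ^ k.+1)%N%:Z %| T (l + N * m)%N)%Z ->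
  exists2 m', (m + j <= m')%N & ((p ^ k) %| m' - m)%N /\
    ((p ^ (k.+1 + j))%N%:Z %| T (l + N * m')%N)%Z.
Proof.
elim: j => [|j IH] k m km.
  by exists m; rewrite ?addn0 // subnn dvdn0.
have [s sk] := T_hensel_step km.
have [m' lem' [dm' Tm']] := IH _ _ sk.
have s0 : (0 < p ^ k * s.+1)%N by rewrite muln_gt0 pk0.
have lemm' : (m + p ^ k * s.+1 <= m')%N by apply: leq_trans lem'; apply: leq_addr.
exists m'; first by apply: leq_trans lem'; rewrite -addnA leq_add2l addnC -addn1 leq_add2l.
split; last by rewrite addnS -addSn.
have -> : (m' - m = (m' - (m + p ^ k * s.+1)) + p ^ k * s.+1)%N.
  by move: lemm'; clear; move: (p ^ k * _)%N => x; lia.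
by rewrite dvdn_add ?dvdn_mulr // (dvdn_trans _ dm') // dvdn_exp2l.
Qed.

End Lift.

End Padic.

Lemma expr_lift_dvd (q k m : nat) (x : algC) : prime q -> q != 2%N -> x \in Aint ->
  (q %| x - 1)%A -> ((q ^ k)%N %| x ^+ (q ^ k * m) - 1)%A.
Proof.
move=> qp q2 xA xq; have q0 := prime_gt0 qp.
have qk0 j : (0 < q ^ j)%N by rewrite expn_gt0 q0.
case/(dvdAP _ q0): (xq) => h hA Dh.
case/(dvdAP _ (qk0 _)): (expr_lift k m qp q2 xA xq) => g gA Dg.
apply/(dvdAP _ (qk0 k)); exists ((q ^ 2)%:R * g + m%:R * (q%:R * h)).
  by rewrite !rpredD ?rpredM ?rpred_nat.
apply/eqP; rewrite -subr_eq0; apply/eqP.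
transitivity (x ^+ (q ^ k * m) - 1 - (q ^ k * m)%:R * (x - 1) - (q ^ k.+2)%:R * g).
  by rewrite Dh -(addn2 k) expnD !natrM; ring.
by rewrite Dg subrr.
Qed.

(** A [d]-th root [rho i] of [r i] gives [rho i ^ b] the role of [r i] to the power [b / d]. Its
    power of exponent [d * N] is [p]-adically close to that of [r i ^+ n], so
    [twisted_zero_of_padic] applies, followed by [twisted_zero_cubic] and [skolem_zeros]. *)
Lemma padic_rational_zero (r : 'I_3 -> algC) (p N : nat) (b : int) (d : nat) :
  trib_roots r -> (r 0)^* = r 0 -> (r 1)^* = r 2%:R -> (r 2%:R)^* = r 1 ->
  prime p -> p != 2%N -> (forall i, (p %| r i ^+ N - 1)%A) -> (0 < N)%N -> (0 < d)%N ->
  (forall k, exists n : nat, ((p ^ k)%N%:Z %| T n)%Z /\ ((p ^ k)%N%:Z %| n%:Z * d - b)%Z) ->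
  exists2 c : int, c \in [:: 0; 1; - 3%:Z; - 5%:Z; - 12%:Z; - 51%:Z] & 3 * b = c * d.
Proof.
move=> rP r0J r1J r2J pp p2 rN N0 d0 approx.
have p0 := prime_gt0 pp.
have pk0 k : (0 < p ^ k)%N by rewrite expn_gt0 p0.
pose rho i := d.-root (r i).
have rhoE i : rho i ^+ d = r i by rewrite rootCK.
have rho0 i : rho i != 0.
  by have := trib_root_neq0 rP i; rewrite -rhoE expf_eq0 d0.
have rhoA i : rho i ^ b \in Aint.
  by apply: (Aint_expr d0); rewrite exprnP exprzAC -exprnP rhoE Aint_trib_rootX.
have M0 : (0 < d * N)%N by rewrite muln_gt0 d0.
have rhoM i : (rho i ^ b) ^+ (d * N) = (r i ^ b) ^+ N.
  by rewrite exprM [(_ ^ b) ^+ d]exprnP exprzAC -exprnP rhoE.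
have [|k|t tM sumt] := @twisted_zero_of_padic p (d * N)
    (fun i => binet_coef (r i) * rho i ^ b) (prime_gt1 pp) M0.
- by move=> i; rewrite rpredM // Aint_binet_coef.
- have [n [Tn nb]] := approx k.
  exists (fun i => binet_coef (r i) * r i ^+ n); split=> [i|i|].
  + by rewrite rpredM ?Aint_binet_coef // rpredX // Aint_trib_root.
  + have rA := Aint_trib_root rP i.
    have unit_r : r i \is a GRing.unit by rewrite unitfE trib_root_neq0.
    rewrite !exprMn -mulrBr mulrC dvdA_mulr ?rpredX ?Aint_binet_coef // rhoM.
    have nE : (r i ^+ n) ^+ (d * N) = (r i ^ (n%:Z * d)) ^+ N.
      by rewrite !exprnP !exprz_exp PoszM mulrA.
    rewrite nE.
    (* As [r i ^+ N] is 1 modulo [p], exponents congruent modulo [p ^ k] give congruent [N]-th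
       powers. *)
    have key (x y : int) s : x = y + (p ^ k * s)%N ->
        ((p ^ k)%N %| (r i ^ x) ^+ N - (r i ^ y) ^+ N)%A.
      move=> ->; rewrite exprzDr // -[r i ^ (p ^ k * s)%N]exprnP exprMn.
      rewrite -{2}[(r i ^ y) ^+ N]mulr1 -mulrBr mulrC dvdA_mulr //.
        by rewrite rpredX // Aint_trib_rootX.
      by rewrite -exprM mulnC exprM expr_lift_dvd // rpredX.
    case/dvdzP: nb => s Ds; case: s Ds => s Ds.
      rewrite -opprB rpredN; apply: (key _ _ s).
      rewrite PoszM -[n%:Z * d in LHS](subrK b) Ds; ring.
    apply: (key _ _ s.+1); rewrite PoszM -[b in LHS](subKr (n%:Z * d)) Ds NegzE; ring.
  + by rewrite (binet n rP) mulrC dvdA_mulr ?rpred_nat // dvdA_int.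
have wM i : (rho i ^ b * t i) ^+ (d * N) = r i ^ (b * N).
  by rewrite exprMn tM mulr1 rhoM exprnP exprz_exp.
have wsum : \sum_i binet_coef (r i) * (rho i ^ b * t i) = 0.
  by rewrite -[RHS]sumt; apply: eq_bigr => i _; rewrite mulrA.
have [c cE csum] := twisted_zero_cubic rP r0J r1J r2J M0 wM wsum.
exists c; first exact (skolem_zeros rP csum).
have Nz : N%:Z != 0 by move: N0; rewrite lt0n.
by apply: (mulIf Nz); rewrite -!mulrA cE PoszM.
Qed.

(** * From valuations to p-adic zeros *)

Lemma vq_int (p : nat) (x : int) :
  vq p x%:~R = if x == 0 then None else Some (logn p `|x|)%:Z.
Proof. by rewrite /vq intr_eq0 numq_int denq_int logn1 subr0. Qed.

Lemma vq_intB (p k n : nat) (a : rat) (v : int) : prime p ->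
  vq p (n%:~R - a) = Some v -> k%:Z <= v ->
  ((p ^ k)%N%:Z %| n%:Z * denq a - numq a)%Z.
Proof.
move=> pp; rewrite /vq; case: eqP => // /eqP na0 [Dv] kv.
set x := n%:~R - a in na0 Dv.
have e : numq x * denq a = (n%:Z * denq a - numq a) * denq x.
  apply: (@intr_inj rat); rewrite !(rmorphM, rmorphB) /=.
  by rewrite !numqE /x; ring.
have nx0 : (0 < `|numq x|)%N by rewrite absz_gt0 numq_eq0.
have dx0 : (0 < `|denq x|)%N by rewrite absz_gt0 denq_neq0.
have da0 : (0 < `|denq a|)%N by rewrite absz_gt0 denq_neq0.
have y0 : (0 < absz (n%:Z * denq a - numq a)%R)%N.
  have := congr1 absz e; rewrite !abszM => E.
  by move: (muln_gt0 `|numq x| `|denq a|); rewrite E nx0 da0 muln_gt0 => /andP[].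
have := congr1 (fun z => logn p `|z|) e; rewrite /= !abszM !lognM // => E.
by rewrite dvdzE /= pfactor_dvdn //; lia.
Qed.

Lemma congq_of_dvd (p : nat) (x y : int) (a : rat) : prime p ->
  (p%:Z %| y * denq a - numq a)%Z -> (p%:Z %| y - x)%Z -> congq p x%:~R a.
Proof.
move=> pp ya yx; exists (denq a); split.
  rewrite coprimez_sym coprimezE /= prime_coprime //; apply/negP => pd.
  have pn : (p%:Z %| numq a)%Z.
    rewrite -[numq a](subKr (y * denq a)) rpredB // dvdz_mull //.
  have := coprime_num_den a; rewrite /coprime => /eqP g1.
  have : (p %| gcdn `|numq a| `|denq a|)%N by rewrite dvdn_gcd pd andbT.
  by rewrite g1 dvdn1 => /eqP p1; rewrite p1 in pp.
exists (denq a * x), (numq a); split; first by rewrite intrM.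
split; first by rewrite numqE mulrC.
rewrite eqz_mod_dvd.
have -> : denq a * x - numq a = (y * denq a - numq a) - (y - x) * denq a by ring.
by rewrite rpredB // dvdz_mulr.
Qed.

Lemma u_of_dvd (p N l : nat) (w t : int) : prime p -> T l = t * p%:Z ->
  u_of p N l w = (l%:Z - t * w * N%:Z)%:~R.
Proof.
move=> pp Dt; have p0 : p%:R != 0 :> rat by rewrite pnatr_eq0 -lt0n prime_gt0.
by rewrite /u_of Dt !(rmorphB, rmorphM) /= mulfK.
Qed.

Lemma expr_dvdA (q : algC) (x : algC) m : x \in Aint -> (q %| x - 1)%A -> (q %| x ^+ m - 1)%A.
Proof.
by move=> xA xq; rewrite subrX1 dvdA_mulr // rpred_sum // => i _; rewrite rpredX.
Qed.

(** Write [Q = Q' * p ^ e] with [Q'] prime to [p]. Steps of length [N * Q'] still have nonzero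
    slope; after [e] liftings the later ones move [m] by multiples of [p ^ e], so the index keeps
    its class modulo [Q]. *)
Lemma padic_zero_class (p N l Q : nat) (r : 'I_3 -> algC) :
  trib_roots r -> prime p -> p != 2%N -> p != 11%N ->
  (forall i, (p %| r i ^+ N - 1)%A) -> (0 < N)%N -> (0 < Q)%N ->
  (p%:Z %| T l)%Z -> ~~ ((p ^ 2)%N%:Z %| T (l + N)%N - T l)%Z ->
  exists2 i : nat, (i < Q)%N & forall K B, exists m : nat,
    [/\ (B <= l + N * m)%N, (l + N * m = i %[mod Q])%N
      & ((p ^ K)%N%:Z %| T (l + N * m)%N)%Z].
Proof.
move=> rP pp p2 p11 rN N0 Q0 Tl TD; have p0 := prime_gt0 pp.
have [Q' copQ DQ] := pfactor_coprime pp Q0; set e := logn p Q in DQ.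
have Q'0 : (0 < Q')%N by move: Q0; rewrite DQ muln_gt0 => /andP[].
have rN' i : (p %| r i ^+ (N * Q') - 1)%A.
  by rewrite exprM expr_dvdA // rpredX // Aint_trib_root.
have TD' : ~~ ((p ^ 2)%N%:Z %| T (l + N * Q')%N - T l)%Z.
  apply: contra TD => h.
  have := T_lift rP pp p2 p11 rN l 0 Q'; rewrite expn0 mul1n => h2.
  have : ((p ^ 2)%N%:Z %| Q'%:Z * (T (l + N)%N - T l))%Z.
    by rewrite -[X in (_ %| X)%Z](subKr (T (l + N * Q')%N - T l)) rpredB.
  by rewrite Gauss_dvdzr // coprimezE /= coprimeXl.
have T0 : ((p ^ 1)%N%:Z %| T (l + N * Q' * 0)%N)%Z by rewrite muln0 addn0 expn1.
have [m0 _ [_ Tm0]] := T_hensel rP pp p2 p11 rN' TD' e T0.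
exists ((l + N * Q' * m0) %% Q)%N => [|K B]; first by rewrite ltn_mod.
rewrite add1n in Tm0.
(* [K] liftings serve the divisibility and [B] the size. *)
have [m lem [dm Tm]] := T_hensel rP pp p2 p11 rN' TD' (K + B) Tm0.
exists (Q' * m)%N; rewrite mulnA; split.
- apply: leq_trans (leq_addl _ _); apply: leq_trans (leq_pmull _ _).
    by apply: leq_trans lem; rewrite addnA leq_addl.
  by rewrite muln_gt0 N0.
- rewrite modn_mod; apply/eqP; rewrite eqn_mod_dvd.
    rewrite subnDl -mulnBr -mulnA DQ dvdn_mull // dvdn_mul //.
  by rewrite leq_add2l leq_mul2l; apply/orP; right; apply: leq_trans lem; apply: leq_addr.
- apply: dvdz_trans Tm; rewrite dvdzE /= dvdn_exp2l //.
  by rewrite addnCA leq_addr.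
Qed.

(** Modulo [p ^ 2] the value is [T l + m * (T (l + N) - T l)]; its vanishing gives [m = - t * w]
    modulo [p]. *)
Lemma padic_zero_approx (p N l m : nat) (w t : int) (r : 'I_3 -> algC) :
  trib_roots r -> prime p -> p != 2%N -> p != 11%N ->
  (forall i, (p %| r i ^+ N - 1)%A) -> T l = t * p%:Z ->
  congq p ((T (l + N)%N - T l)%:~R / p%:R * w%:~R) 1 ->
  ((p ^ 2)%N%:Z %| T (l + N * m)%N)%Z ->
  (p%:Z %| (l + N * m)%N%:Z - (l%:Z - t * w * N%:Z))%Z.
Proof.
move=> rP pp p2 p11 rN Dt [k [copk [x [y [Dx [Dy /eqP xy]]]]]] Tm.
have [d Dd] : exists d, T (l + N)%N - T l = d * p%:Z.
  by apply/dvdzP; have := T_period rP pp p2 p11 rN l 1; rewrite muln1.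
have p_neq0 : p%:Z != 0 by have := prime_gt0 pp; rewrite lt0n.
have /dvdzP[c Dc] : (p%:Z %| d * w - 1)%Z.
  rewrite -(@Gauss_dvdzr _ k) 1?coprimez_sym //.
  have <- : x - y = k * (d * w - 1).
    apply: (@intr_inj rat); rewrite rmorphB /= -Dx -Dy Dd !(rmorphB, rmorphM) /= mulfK.
      by ring.
    by rewrite intr_eq0.
  by rewrite -eqz_mod_dvd; apply/eqP.
have /dvdzP[f Df] := T_lift rP pp p2 p11 rN l 0 m.
have /dvdzP[g Dg] := Tm.
rewrite expn0 mul1n Dg Dd Dt in Df.
have {}Df : t + m%:Z * d = (g - f) * p%:Z.
  by apply: (mulIf p_neq0); move: Df; rewrite -mulnn PoszM => Df; lia.
apply/dvdzP; exists (N%:Z * ((g - f) * w - m%:Z * c)).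
rewrite PoszD PoszM.
have -> : N%:Z * ((g - f) * w - m%:Z * c) * p = N%:Z * (((g - f) * p%:Z) * w - m%:Z * (c * p%:Z)) by ring.
by rewrite -Df -Dc; ring.
Qed.

(* On the class of [padic_zero_class] case (C) fails, and case (L) forces [a]
   to be the [p]-adic limit of the approximate zeros. *)
Lemma class_with_padic_zero (p N l Q : nat) (w : int) (r : 'I_3 -> algC) :
  trib_roots r -> (r 0)^* = r 0 -> (r 1)^* = r 2%:R -> (r 2%:R)^* = r 1 ->
  prime p -> p != 2%N -> p != 11%N ->
  (forall i, (p %| r i ^+ N - 1)%A) -> (0 < N)%N -> (0 < Q)%N ->
  (p%:Z %| T l)%Z -> ~~ ((p ^ 2)%N%:Z %| T (l + N)%N - T l)%Z ->
  congq p ((T (l + N)%N - T l)%:~R / p%:R * w%:~R) 1 ->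
  exists2 i : nat, (i < Q)%N & ~ caseC p Q i /\
    forall a, caseL p Q i a ->
      (exists2 c : int, c \in [:: 0; 1; - 3%:Z; - 5%:Z; - 12%:Z; - 51%:Z] &
        3 * numq a = c * denq a) /\ congq p (u_of p N l w) a.
Proof.
move=> rP r0J r1J r2J pp p2 p11 rN N0 Q0 Tl TD hw.
have [i iQ approx] := padic_zero_class rP pp p2 p11 rN N0 Q0 Tl TD.
have toZ n : (n = i %[mod Q])%N -> (n%:Z == i%:Z %[mod Q%:Z])%Z.
  by move=> E; rewrite !modz_nat E.
exists i => //; split=> [[kappa [B CB]]|a [kappa [mu [mu0 [_ [B CB]]]]]].
  have [m [Bm /toZ im Tm]] := approx kappa.+1 B.
  have := CB (l + N * m)%N Bm im; rewrite vq_int; case: eqP => // /eqP Tm0 [Ek].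
  move: Tm; rewrite dvdzE /= pfactor_dvdn //; last by rewrite absz_gt0.
  by rewrite Ek ltnn.
have lim k : exists m, ((p ^ k)%N%:Z %| T (l + N * m)%N)%Z /\
    ((p ^ k)%N%:Z %| (l + N * m)%N%:Z * denq a - numq a)%Z.
  (* With this precision, [kappa + mu * v] is at least [k + |kappa| + mu * k], whence [v >= k]. *)
  have [m [Bm /toZ im Tm]] := approx (k + (`|kappa| + mu * k))%N B.
  exists m; split.
    by apply: dvdz_trans Tm; rewrite dvdzE /= dvdn_exp2l // leq_addr.
  have := CB (l + N * m)%N Bm im; rewrite vq_int; case Ev : (vq p _) => [v|]; last first.
    (* Infinite valuation: [a] is the index itself, and the difference is 0. *)
    move=> _; move: Ev; rewrite /vq; case: eqP => // /eqP.
    rewrite subr_eq0 => /eqP <- _.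
    by rewrite denq_int numq_int mulr1 subrr.
  case: eqP => // /eqP Tm0; rewrite [omap _ _]/= => -[Ek].
  apply: (vq_intB pp Ev).
  move: Tm; rewrite dvdzE pfactor_dvdn //; last by rewrite absz_gt0.
  move: Ek; move: (logn _ _) => z Ek kz.
  have h : mu%:Z * k%:Z <= mu%:Z * v.
    by move: Ek kz; clear; rewrite -PoszM; move: (mu * k)%N (mu%:Z * v) => x y; lia.
  by move: h; rewrite ler_pM2l // ltz_nat.
split.
  have d0 : (0 < `|denq a|)%N by rewrite absz_gt0 denq_neq0.
  have dE : `|denq a|%N%:Z = denq a by rewrite gez0_abs // ltW ?denq_gt0.
  rewrite -dE; apply: (padic_rational_zero rP r0J r1J r2J pp p2 rN N0 d0) => k.
  have [m [Tm am]] := lim k; exists (l + N * m)%N.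
  by rewrite dE.
have /dvdzP[t Dt] := Tl.
(* Precision [p ^ 2] is what determines [u] modulo [p]. *)
have [m [Tm am]] := lim 2.
rewrite (u_of_dvd _ _ pp Dt); apply: (congq_of_dvd pp _ (padic_zero_approx rP pp p2 p11 rN Dt hw Tm)).
by apply: dvdz_trans am; rewrite dvdzE /= -mulnn dvdn_mulr.
Qed.

Theorem theorem22 (p : nat) (L : finFieldType) (r1 r2 r3 : L)
  (hp : prime p) (hp2 : p != 2%N) (hp11 : p != 11%N)
  (hchar : p \in [pchar L])
  (hsplit : tribpoly L = ('X - r1%:P) * ('X - r2%:P) * ('X - r3%:P))
  (l : nat) (w : int)
  (hl : (l < gen_order r1 r2 r3)%N)
  (h1 : (p%:Z %| T l)%Z)
  (h2 : ~ (T (l + gen_order r1 r2 r3)%N == T l %[mod (p ^ 2)%N%:Z])%Z)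
  (hw : congq p (((T (l + gen_order r1 r2 r3)%N - T l)%:~R / p%:R) * w%:~R) 1) :
  ((forall c : rat, c \in [:: 0; -1; -4; -17] ->
       ~ congq p (u_of p (gen_order r1 r2 r3) l w) c) -> ~ ML p)
  /\
  (p != 3%N ->
     (forall c : rat, c \in [:: 0; -1; -4; -17; 1/3; -5/3] ->
       ~ congq p (u_of p (gen_order r1 r2 r3) l w) c) -> ~ MLR p).
Proof.
have [r [rP r0J r1J r2J]] := roots_numbering_exists.
have [_ _ _ [r10 r20 r30]] := tribpoly_roots_neq hchar hp2 hp11 hsplit.
have [r1N r2N r3N] := gen_orderP r10 r20 r30.
move: (gen_order r1 r2 r3) hl h2 hw r1N r2N r3N => N _ TD hw r1N r2N r3N N0.
have rN i := trib_root_period i rP hchar hp2 hp11 hsplit r1N r2N r3N.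
have {}TD : ~~ ((p ^ 2)%N%:Z %| T (l + N)%N - T l)%Z by rewrite -eqz_mod_dvd; apply/negP.
have key Q (Q0 : (0 < Q)%N) :=
  class_with_padic_zero rP r0J r1J r2J hp hp2 hp11 rN N0 Q0 h1 TD hw.
split=> [hu|_ hu] [Q [Q0 QP]]; have [i iQ [noC onlyL]] := key Q Q0.
- case: (QP i iQ) => [/noC //|[a /onlyL[[c cE]]]].
  rewrite numq_int denq_int mulr1 => Dc; apply: hu.
  (* Here [3 * a = c], and neither 1 nor -5 is a multiple of 3. *)
  have : a \in [:: 0; -1; - 4%:Z; - 17%:Z].
    move: cE Dc; rewrite !inE => /or4P[|||/or3P[]] /eqP -> Dc; lia.
  by rewrite !inE => /or4P[] /eqP ->.
- case: (QP i iQ) => [/noC //|[a /onlyL[[c cE] Dc]]]; apply: hu.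
  have -> : a = c%:~R / 3%:R.
    have d0 : (denq a)%:~R != 0 :> rat by rewrite intr_eq0 denq_neq0.
    apply: (mulIf d0); have := congr1 (intr : int -> rat) Dc.
    by rewrite !rmorphM /= numqE => E; apply: (mulfI (_ : 3%:R != 0)) => //; rewrite E; field.
  by move: cE; rewrite !inE => /or4P[|||/or3P[]] /eqP ->.
Qed.
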